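(* Let $W(\mathrm{d} x, \mathrm{d} y)$ be a white noise on the horizontal strip $\mathbb{R}\times [0,1]$ whose intensity measure is the standard Lebesgue measure. Put $$Z(u) := \frac{1}{(\log 2)^{1/2}} \int_{\mathbb{R}\times [0,1]} \left( \mathbf{1}_{\{y \leq \exp(-e^{-(x-u)})\}} -\exp(-e^{-(x-u)})\right)W(\mathrm{d} x, \mathrm{d} y),\qquad u\in \mathbb{R}.$$ Then $Z:=(Z(u))_{u\in \mathbb{R}}$ is a stationary centered Gaussian process whose covariance function is given by $$\mathrm{Cov}\,(Z(u), Z(v)) = \frac{\log (1 + e^{- |u-v|})}{\log 2},\qquad u,v\in \mathbb{R}.$$ Furthermore, the process $Z$ has a version with sample paths which are Hölder continuous with exponent $\alpha$, for every $\alpha\in (0,1/2)$.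
   Context: White noise with intensity measure $\mu$ (here Lebesgue measure on $\mathbb{R}\times[0,1]$) is the centered Gaussian random measure $W$ for which the integrals $\int f\,\mathrm{d}W$, $f\in L^2(\mu)$, are jointly centered Gaussian with $\mathbb{E}\big[\int f\,\mathrm{d}W\int g\,\mathrm{d}W\big]=\int fg\,\mathrm{d}\mu$. $\mathbf{1}_{\{\cdot\}}$ denotes the indicator function, and $\mathrm{Cov}\,(X,Y)=\mathbb{E}XY-\mathbb{E}X\,\mathbb{E}Y$ is the covariance. *)

(* Defs.v *)
From HB Require Import structures.
From mathcomp Require Import all_boot all_order all_algebra.
From mathcomp Require Import all_classical all_reals all_analysis.
From mathcomp Require Import measurable_realfun.

Set Implicit Arguments.
Unset Strict Implicit.
Unset Printing Implicit Defensive.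

Import Order.TTheory GRing.Theory Num.Theory.
Import numFieldNormedType.Exports.

Local Open Scope classical_set_scope.
Local Open Scope ring_scope.

(* [normal_prob m 0] is not the Dirac mass at m in the library (it is the
   uniform law on [0, 1]), so the degenerate case is treated separately. *)
Definition gaussian_law (R : realType) (m s : R) (B : set R) : \bar R :=
  if s == 0 then \d_m B else normal_prob m s B.

Section processes.
Context d (T : measurableType d) (R : realType) (P : probability T R).

(* The members of the family indexed by D are jointly Gaussian: all their
   finite linear combinations are (possibly degenerate) Gaussian. *)
Definition jointly_gaussian (I : Type) (D : set I) (X : I -> {RV P >-> R}) :=
  forall (n : nat) (i : 'I_n -> I) (c : 'I_n -> R), (forall k, D (i k)) ->
  exists m s : R, forall B : set R, measurable B ->
    pushforward P (fun w => \sum_(k < n) c k * X (i k) w) B = gaussian_law m s B.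

Definition gaussian_process (X : R -> {RV P >-> R}) :=
  jointly_gaussian [set: R] X.

Definition centered (X : R -> {RV P >-> R}) := forall u, ('E_P[X u] = 0)%E.

(* Strict stationarity: all finite-dimensional distributions, as laws on the
   product sigma-algebra of R^n, are invariant under time shifts. *)
Definition stationary (X : R -> {RV P >-> R}) :=
  forall (n : nat) (u : 'I_n -> R) (h : R) (B : set (n.-tuple R)),
    measurable B ->
    pushforward P (fun w => [tuple X (u k + h) w | k < n]) B =
    pushforward P (fun w => [tuple X (u k) w | k < n]) B.

(* Y is a version (modification) of X. *)
Definition version_of (X Y : R -> {RV P >-> R}) :=
  forall u, {ae P, forall w, Y u w = X u w}.

End processes.

(* Hölder continuity of a function on the whole line is understood on compact
   intervals, the constant C being allowed to depend on the interval. *)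
Definition hoelder_continuous (R : realType) (alpha : R) (g : R -> R) :=
  forall a b : R, exists C : R, forall s t : R, s \in `[a, b] -> t \in `[a, b] ->
    `|g s - g t| <= C * `|s - t| `^ alpha.

(* White noise with intensity mu is given through its integrals: [W f] is the
   random variable \int f dW for f in L^2(mu) (and is unconstrained for other f),
   and the random measure itself is A |-> W \1_A, for A of finite mu-measure.
   Almost sure linearity of W and its sigma-additivity in L^2(P) follow from
   [wn_covariance]. *)
Record white_noise d (T : measurableType d) d' (S : measurableType d')
    (R : realType) (mu : {measure set S -> \bar R}) (P : probability T R)
    (W : (S -> R) -> {RV P >-> R}) : Prop := WhiteNoise {
  wn_gaussian : jointly_gaussian [set f | f \in Lfun mu 2%:E] W ;
  wn_centered : forall f, f \in Lfun mu 2%:E -> ('E_P[W f] = 0)%E ;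
  wn_covariance : forall f g, f \in Lfun mu 2%:E -> g \in Lfun mu 2%:E ->
    ('E_P[fun w => (W f w * W g w)%R] = \int[mu]_p (f p * g p)%:E)%E
}.

Section strip.
Context (R : realType).
Local Notation RR := (measurableTypeR R * measurableTypeR R)%type.

Definition strip : set RR := [set: R] `*` `[0, 1].

Lemma measurable_strip : measurable strip.
Proof. exact: measurableX. Qed.

Definition strip_measure : {measure set RR -> \bar R} :=
  mrestr (@lebesgue_measure R \x @lebesgue_measure R)%E measurable_strip.

Definition Zkernel (u : R) (p : RR) : R :=
  \1_[set q : R * R | q.2 <= expR (- expR (- (q.1 - u)))] p
  - expR (- expR (- (p.1 - u))).

End strip.

Definition Zprocess d (T : measurableType d) (R : realType)
    (P : probability T R)
    (W : (measurableTypeR R * measurableTypeR R -> R) -> {RV P >-> R})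
    (u : R) : {RV P >-> R} :=
  (Num.sqrt (ln 2))^-1 \o* W (Zkernel u).

(* Main.v *)
Require Import Defs.
From HB Require Import structures.
From mathcomp Require Import all_boot all_order all_algebra.
From mathcomp Require Import all_classical all_reals all_analysis.
From mathcomp Require Import measurable_realfun.
From mathcomp Require Import ring lra zify.
Set Implicit Arguments.
Unset Strict Implicit.
Unset Printing Implicit Defensive.
Import Order.TTheory GRing.Theory Num.Theory.
Import numFieldNormedType.Exports.
Local Open Scope classical_set_scope.
Local Open Scope ring_scope.

(** Joint Gaussianity and centering of Z are inherited from the white noise, so
    everything is governed by the covariance.  Write F_u(x) = exp(-exp(-(x-u)))
    for the shifted Gumbel distribution function.  For fixed x the kernel of Z
    is, as a function of a uniform variable y, a centered indicator, so that
    integrating the product of two kernels over y gives the covariance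
    F_v - F_u F_v of two indicators when u <= v.  The Gumbel family is
    max-stable: F_u F_v = F_w with exp w = exp u + exp v.  Hence the covariance
    is the area between the graphs of two translates of one distribution
    function, and slicing that area horizontally shows it to be the translation
    length w - v = ln (1 + exp(u-v)) (integral_gumbel_diff, integral_ZkernelM).

    The covariance depends on u - v only.  Laws of linear combinations of Z are
    centered normal, hence determined by their variance, hence invariant under
    shifts; the Cramer-Wold device (cramer_wold_device) lifts this to the
    finite-dimensional distributions, which is stationarity.  The device is
    proved without Fourier inversion: the bounded functions whose integrals
    against the two measures agree contain the trigonometric functions of linear
    forms, which span an algebra, and are stable under bounded pointwise limits.
    From the algebra such limits first produce the signs of x_k - a, hence the
    indicators of half-spaces, and finally the indicators of all Borel sets.

    Finally E (Z u - Z v)^2 <= C |u - v| because ln 2 - ln (1 + exp(-h)) <= h,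
    and the even moments of a centered normal variable are constant multiples of
    powers of its variance, so E (Z u - Z v)^(2p) <= C_p |u - v|^p for all p.
    Kolmogorov's criterion (kolmogorov_continuity) turns this into a version
    with Hoelder paths.  Almost surely, for arbitrarily large p and on every
    bounded interval, a weighted sum of the 2p-th powers of the dyadic increments
    is finite since its expectation is; each increment is then controlled by that
    sum, which yields all exponents below 1/2 outside a single null set, on which
    the paths are replaced by 0. *)

(** * Preliminaries *)

Lemma cvg_eventually_cst (R : realType) (u : nat -> R) (l : R) :
  (\forall m \near \oo, u m = l) -> u m @[m --> \oo] --> l.
Proof. by move=> h; apply: cvg_near_cst. Qed.

Lemma exprn_even_ge0 (R : realType) (x : R) p : 0 <= x ^+ p.*2.
Proof. by rewrite -muln2 exprM sqr_ge0. Qed.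

(** * The Cramer-Wold device *)

(** Least class containing B and stable under linear combinations and under limits
    of uniformly bounded, pointwise convergent sequences.  Products are left out on
    purpose: equality of integrals against two measures passes to linear
    combinations and, by dominated convergence, to bounded limits, but not to
    products. *)
Inductive bp_closure (R : realType) (U : Type) (B : set (U -> R)) : (U -> R) -> Prop :=
| bp_base f : B f -> bp_closure B f
| bp_lin a f g : bp_closure B f -> bp_closure B g ->
    bp_closure B (fun x => a * f x + g x)
| bp_lim (f_ : nat -> U -> R) f M : (forall m, bp_closure B (f_ m)) ->
    (forall m x, `|f_ m x| <= M) ->
    (forall x, f_ ^~ x @ \oo --> f x) -> bp_closure B f.

Section bp_closure_theory.
Context (R : realType) (U : Type) (B : set (U -> R)).
Hypothesis B_bounded : forall f, B f -> exists M, forall x, `|f x| <= M.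
Hypothesis B_mul : forall f g, B f -> B g -> bp_closure B (f \* g).
Hypothesis B_one : bp_closure B (cst 1).
Implicit Types f g : U -> R.

Lemma eq_bp_closure f g : f =1 g -> bp_closure B f -> bp_closure B g.
Proof. by move=> /funext ->. Qed.

Lemma bp_closure_bounded f : bp_closure B f ->
  exists2 M, 0 <= M & forall x, `|f x| <= M.
Proof.
elim=> [{}f /B_bounded[M fM]|a {}f g _ [M M0 fM] _ [N N0 gN]|f_ {}f M _ _ fM cf].
- by exists `|M| => // x; rewrite (le_trans (fM x))// ler_norm.
- exists (`|a| * M + N); first by rewrite addr_ge0// mulr_ge0.
  move=> x; rewrite (le_trans (ler_normD _ _))// lerD// normrM.
  by rewrite ler_wpM2l.
- exists `|M| => // x.
  have : limn (fun n => `|f_ n x|) <= M.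
    apply: limr_le; last by near=> n; exact: fM.
    by apply/cvg_ex; exists `|f x|; apply: cvg_norm; exact: cf.
  rewrite (cvg_lim _ (cvg_norm (cf x)))// => /le_trans; apply.
  exact: ler_norm.
Unshelve. all: end_near. Qed.

Lemma bp_closureZ a f : bp_closure B f -> bp_closure B (a \*o f).
Proof.
move=> cf; have c0 : bp_closure B (fun x => (-1) * f x + f x) by exact: bp_lin.
by apply: (eq_bp_closure _ (bp_lin a cf c0)) => x /=; ring.
Qed.

Lemma bp_closureD f g : bp_closure B f -> bp_closure B g -> bp_closure B (f \+ g).
Proof.
by move=> cf cg; apply: (eq_bp_closure _ (bp_lin 1 cf cg)) => x /=; rewrite mul1r.
Qed.

Lemma bp_closureB f g : bp_closure B f -> bp_closure B g -> bp_closure B (f \- g).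
Proof.
move=> cf cg; apply: (eq_bp_closure _ (bp_lin (-1) cg cf)) => x /=.
by rewrite mulN1r addrC.
Qed.

Lemma bp_closure_cst c : bp_closure B (cst c).
Proof. by apply: (eq_bp_closure _ (bp_closureZ c B_one)) => x /=; rewrite mulr1. Qed.

(** Stability of products of B suffices: for f in B the set of g with f g in the
    closure contains B and is stable under combinations and bounded limits, hence
    is everything; repeating the argument with g fixed removes f in B. *)
Lemma bp_closureM f g : bp_closure B f -> bp_closure B g -> bp_closure B (f \* g).
Proof.
move=> cf; elim: cf g => [{}f Bf|a {}f h _ IHf _ IHh|f_ {}f M _ IHf fM cf] g cg.
- elim: cg => [{}g Bg|a {}g h _ IHg _ IHh|g_ {}g M _ IHg gM cg].
  + exact: B_mul.
  + by apply: (eq_bp_closure _ (bp_lin a IHg IHh)) => x /=; ring.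
  + have [N N0 fN] := bp_closure_bounded (bp_base Bf).
    apply: (@bp_lim _ _ _ (fun m => f \* g_ m) _ (N * M)) => // [m x|x] /=.
      by rewrite normrM ler_pM.
    by apply: cvgM; [exact: cvg_cst|exact: cg].
- by apply: (eq_bp_closure _ (bp_lin a (IHf _ cg) (IHh _ cg))) => x /=; ring.
- have [N N0 gN] := bp_closure_bounded cg.
  apply: (@bp_lim _ _ _ (fun m => f_ m \* g) _ (M * N)) => [m|m x|x] /=.
  + exact: IHf.
  + by rewrite normrM ler_pM.
  + by apply: cvgM; [exact: cf|exact: cvg_cst].
Qed.

Lemma bp_closure_indicC (A : set U) : bp_closure B \1_A -> bp_closure B \1_(~` A).
Proof.
move=> cA; apply: (eq_bp_closure _ (bp_closureB B_one cA)) => x /=.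
by rewrite !indicE in_setC; case: (x \in A); rewrite ?subr0 ?subrr.
Qed.

Lemma bp_closure_indicI (A C : set U) :
  bp_closure B \1_A -> bp_closure B \1_C -> bp_closure B \1_(A `&` C).
Proof.
move=> cA cC; apply: (eq_bp_closure _ (bp_closureM cA cC)) => x /=.
by rewrite indicI.
Qed.

Lemma bp_closure_indic_bigcup (A : nat -> set U) :
  (forall i, bp_closure B \1_(A i)) -> bp_closure B \1_(\bigcup_i A i).
Proof.
move=> cA.
have c0 : bp_closure B \1_(set0 : set U).
  by apply: (eq_bp_closure _ (bp_closure_cst 0)) => x; rewrite indic0.
have cU n : bp_closure B \1_(\big[setU/set0]_(i < n) A i).
  elim: n => [|n IHn]; first by rewrite big_ord0.
  rewrite big_ord_recr/= -[X in \1_X]setCK setCU.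
  by apply: bp_closure_indicC; apply: bp_closure_indicI; exact: bp_closure_indicC.
apply: (@bp_lim _ _ _ _ _ 1 cU) => [m x|x].
  by rewrite indicE ger0_norm// lern1 leq_b1.
have [[i _ Aix]|Ax] := pselect ((\bigcup_i A i) x).
- apply: cvg_eventually_cst; near=> n; rewrite !indicE !mem_set//.
    by exists i.
  rewrite -(bigcup_mkord n A); exists i => //=.
  by near: n; exact: nbhs_infty_gt.
- apply: cvg_eventually_cst; near=> n; rewrite !indicE !memNset//.
  by rewrite -(bigcup_mkord n A) => -[j _ Ajx]; apply: Ax; exists j.
Unshelve. all: end_near. Qed.

(** Complements, intersections and increasing unions of sets translate into
    differences, products and bounded pointwise limits of indicators. *)
Lemma sigma_algebra_bp_closure :
  sigma_algebra setT [set A : set U | bp_closure B \1_A].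
Proof.
split=> /=.
- by apply: (eq_bp_closure _ (bp_closure_cst 0)) => x; rewrite indic0.
- by move=> A cA; rewrite setTD; exact: bp_closure_indicC.
- exact: bp_closure_indic_bigcup.
Qed.

End bp_closure_theory.

Section smoothstep.
Context {R : realType}.

(** A polynomial with attracting fixed points -1 and 1 and repelling fixed point 0:
    its iterates are polynomials approximating the sign function on [-1, 1]. *)
Definition smoothstep (t : R) : R := (3%:R * t - t ^+ 3) / 2%:R.

Lemma smoothstep_ge (t : R) : 0 <= t <= 1 -> t <= smoothstep t <= 1.
Proof.
move=> /andP[t0 t1]; have u0 : 0 <= 1 - t by rewrite subr_ge0.
have h1 : 0 <= t * (1 - t) * (1 + t) / 2%:R by rewrite !mulr_ge0// addr_ge0.
have h2 : 0 <= (1 - t) ^+ 2 * (t + 2%:R) / 2%:R.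
  by rewrite !mulr_ge0 ?sqr_ge0// addr_ge0.
rewrite /smoothstep -subr_ge0 -[X in _ && X]subr_ge0; apply/andP; split.
  by apply: le_trans h1 _; rewrite le_eqVlt; apply/orP; left; apply/eqP; field.
by apply: le_trans h2 _; rewrite le_eqVlt; apply/orP; left; apply/eqP; field.
Qed.

Lemma smoothstepN t : smoothstep (- t) = - smoothstep t.
Proof. by rewrite /smoothstep; ring. Qed.

Lemma iter_smoothstepN n t : iter n smoothstep (- t) = - iter n smoothstep t.
Proof. by elim: n => //= n ->; rewrite smoothstepN. Qed.

Lemma iter_smoothstep_bound n t : 0 <= t <= 1 -> 
  t <= iter n smoothstep t <= 1 /\ 1 - iter n smoothstep t <= (1 - t / 2%:R) ^+ n.
Proof.
move=> /andP[t0 t1]; elim: n => [|n /= [IH1 IH2]].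
  by rewrite /= lexx t1 expr0; split=> //; lra.
set q := iter n _ _ in IH1 IH2 *; have /andP[tq q1] := IH1.
have /andP[qs s1] := smoothstep_ge (introT andP (conj (le_trans t0 tq) q1)).
split; first by rewrite (le_trans tq qs).
rewrite exprS; apply: (@le_trans _ _ ((1 - t / 2%:R) * (1 - q))).
  have q0 := le_trans t0 tq; have u0 : 0 <= 1 - q by rewrite subr_ge0.
  have -> : 1 - smoothstep q = (1 - q / 2%:R - q ^+ 2 / 2%:R) * (1 - q).
    (* 1 - smoothstep q = (1 - q)^2 (1 + q / 2): the error contracts geometrically *)
    by rewrite /smoothstep; field.
  by apply: ler_wpM2r => //; have := sqr_ge0 q; lra.
by rewrite ler_wpM2l//; lra.
Qed.

Lemma cvg_iter_smoothstep t : -1 <= t <= 1 ->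
  iter n smoothstep t @[n --> \oo] --> Num.sg t.
Proof.
have pos (s : R) : 0 < s -> s <= 1 -> iter n smoothstep s @[n --> \oo] --> (1 : R).
  move=> s0 s1.
  have h n := iter_smoothstep_bound n (introT andP (conj (ltW s0) s1)).
  apply: (@squeeze_cvgr _ _ _ _ (fun n => 1 - (1 - s / 2%:R) ^+ n) (cst 1)).
  - near=> n; have [/andP[_ ->] h2] := h n; rewrite andbT; lra.
  - rewrite -[X in _ --> X]subr0; apply: cvgB; first exact: cvg_cst.
    by apply: cvg_expr; rewrite ger0_norm; lra.
  - exact: cvg_cst.
move=> /andP[tN1 t1]; have [t0|t0|->] := ltrgt0P t.
- by rewrite gtr0_sg//; exact: pos.
- rewrite ltr0_sg//.
  have := pos (- t); rewrite oppr_gt0 t0 => /(_ isT); rewrite lerNl tN1 => /(_ isT).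
  rewrite (_ : (fun n => iter n smoothstep t) =
      (fun n => - iter n smoothstep (- t))); first exact: cvgN.
  by apply/funext => n; rewrite iter_smoothstepN opprK.
- rewrite sgr0; apply: cvg_eventually_cst; near=> n.
  have := iter_smoothstepN n 0; rewrite oppr0 => h; lra.
Unshelve. all: end_near. Qed.

End smoothstep.

Section cramer_wold.
Context {R : realType} {n : nat}.
Implicit Types c : 'I_n -> R.

Definition linear_form c (x : n.-tuple R) : R := \sum_(k < n) c k * tnth x k.

(** The phase b makes this one family contain both cosines and sines. *)
Definition trig_functions : set (n.-tuple R -> R) :=
  [set f | exists c b, f = fun x => cos (linear_form c x + b)].

Local Notation cl := (bp_closure trig_functions).

Lemma linear_formD a c c' (x : n.-tuple R) :
  linear_form (fun k => c k + a * c' k) x = linear_form c x + a * linear_form c' x.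
Proof.
rewrite /linear_form mulr_sumr -big_split/=; apply: eq_bigr => k _.
by rewrite mulrDl mulrA.
Qed.

Lemma measurable_linear_form c : measurable_fun setT (linear_form c).
Proof.
rewrite /linear_form; apply: measurable_sum => k.
by apply: measurable_funM => //; exact: measurable_tnth.
Qed.

Lemma trig_bounded f : trig_functions f -> exists M, forall x, `|f x| <= M.
Proof. by move=> [c [b ->]]; exists 1 => x; exact: cos_max. Qed.

Lemma trigM f g : trig_functions f -> trig_functions g -> cl (f \* g).
Proof.
move=> [c [b ->]] [c' [b' ->]].
have base c0 b0 : cl (fun x => cos (linear_form c0 x + b0)).
  by apply: bp_base; exists c0, b0.
pose h := bp_closureD (base (fun k => c k + 1 * c' k) (b + b'))
                      (base (fun k => c k + (-1) * c' k) (b - b')).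
apply: (eq_bp_closure _ (bp_closureZ (2%:R^-1) h)) => x /=.
rewrite !linear_formD mul1r mulN1r.
set u := linear_form c x; set v := linear_form c' x.
have -> : u + v + (b + b') = (u + b) + (v + b') by ring.
have -> : u - v + (b - b') = (u + b) - (v + b') by ring.
by rewrite cosD cosB; field.
Qed.

Lemma trig1 : cl (cst 1).
Proof.
apply: bp_base; exists (fun=> 0), 0; apply/funext => x.
by rewrite /linear_form big1 ?addr0 ?cos0// => k _; rewrite mul0r.
Qed.

Lemma trig_sin k a (L : R) : cl (fun x => sin ((tnth x k - a) / L)).
Proof.
apply: bp_base; exists (fun j => (j == k)%:R / L), (- a / L - pi / 2%:R).
apply/funext => x; rewrite addrA cosBpihalf; congr sin.
rewrite /linear_form (bigD1 k)//= eqxx big1 ?addr0; first by rewrite mul1r; ring.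
by move=> j /negPf ->; rewrite !mul0r.
Qed.

Lemma sg_sin_near (y : R) : \forall m \near \oo, Num.sg (sin (y / m.+1%:R)) = Num.sg y.
Proof.
have pos (z : R) : 0 < z -> \forall m \near \oo, 0 < sin (z / m.+1%:R).
  move=> z0; near=> m; apply: sin_gt0_pihalf; rewrite divr_gt0//=.
  rewrite ltr_pdivrMr//; apply: (@le_lt_trans _ _ (m%:R * 1)).
    by rewrite mulr1; near: m; exact: nbhs_infty_ger.
  have p1 : 1 <= pi / 2%:R :> R by rewrite ler_pdivlMr// mul1r; exact: pi_ge2.
  rewrite mulrC (@lt_le_trans _ _ (1 * m.+1%:R))// ?ler_wpM2r//.
  by rewrite ltr_pM2l// ltr_nat.
have [y0|y0|->] := ltrgt0P y.
- near=> m; rewrite !gtr0_sg//; near: m; exact: pos.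
- near=> m; rewrite !ltr0_sg// -oppr_gt0 -sinN -mulNr; near: m; apply: pos.
  by rewrite oppr_gt0.
- by near=> m; rewrite mul0r sin0.
Unshelve. all: end_near. Qed.

(** Iterating smoothstep turns sin ((x_k - a) / m) into its sign, which for large m
    is the sign of x_k - a. *)
Lemma trig_sg k a : cl (fun x => Num.sg (tnth x k - a)).
Proof.
have clM := bp_closureM trig_bounded trigM.
have sg1 (t : R) : `|Num.sg t| <= 1.
  by rewrite normr_sg lern1 leq_b1.
have h m : cl (fun x => Num.sg (sin ((tnth x k - a) / m.+1%:R))).
  pose s := fun x : n.-tuple R => sin ((tnth x k - a) / m.+1%:R).
  have s1 x : -1 <= s x <= 1 by rewrite sin_geN1 sin_le1.
  apply: (@bp_lim _ _ _ (fun j x => iter j smoothstep (s x)) _ 1).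
  - elim=> [|j IHj]; first exact: trig_sin.
    have c2 := clM _ _ IHj (clM _ _ IHj IHj).
    apply: (eq_bp_closure _ (bp_closureB (bp_closureZ (3%:R / 2%:R) IHj)
      (bp_closureZ (2%:R^-1) c2))) => x /=.
    by rewrite /smoothstep; field.
  - move=> j x; rewrite ler_norml; have /andP[sN1 sp1] := s1 x.
    have [s0|/ltW s0] := leP 0 (s x).
      have [/andP[h1 ->] _] := iter_smoothstep_bound j (introT andP (conj s0 sp1)).
      by rewrite andbT; lra.
    have s0' : 0 <= - s x <= 1 by rewrite oppr_ge0 s0 lerNl.
    have [/andP[h1 h2] _] := iter_smoothstep_bound j s0'.
    rewrite iter_smoothstepN in h1 h2; apply/andP; split; lra.
  - by move=> x; exact: cvg_iter_smoothstep.
apply: (@bp_lim _ _ _ (fun m x => Num.sg (sin ((tnth x k - a) / m.+1%:R))) _ 1) => //.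
move=> x; apply: cvg_eventually_cst; exact: sg_sin_near.
Qed.

Lemma trig_indic_ray k a : cl \1_[set x : n.-tuple R | a < tnth x k].
Proof.
have clM := bp_closureM trig_bounded trigM.
have s := trig_sg k a.
(* if t is -1, 0 or 1 then (t + t^2) / 2 is the indicator of t = 1 *)
apply: (eq_bp_closure _ (bp_closureZ (2%:R^-1) (bp_closureD s (clM _ _ s s)))) => x /=.
rewrite indicE; have [xa|xa] := ltP a (tnth x k).
  by rewrite mem_set//= gtr0_sg ?subr_gt0//; field.
rewrite memNset /=; last by apply/negP; rewrite -leNgt.
by have [h|h|->] := ltrgt0P (tnth x k - a); [lra|rewrite ltr0_sg//; field|rewrite sgr0; field].
Qed.

Lemma trig_indic_measurable (A : set (n.-tuple R)) : measurable A -> cl \1_A.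
Proof.
have sT := sigma_algebra_bp_closure trig_bounded trigM trig1.
move: A; rewrite [measurable]/(@g_sigma_preimage _ _ _ n _).
apply: smallest_sub => //; move=> A.
rewrite -bigcup_seq/= => -[k _ [C mC <-]]; rewrite setTI.
have {mC} : (@ocitv R).-sigma.-measurable C by [].
rewrite RGenOInfty.measurableE; move: C; apply: smallest_sub.
  split=> [|C|F] /=.
  - by rewrite preimage_set0; have [] := sT.
  - by move=> cC; have [_ + _] := sT => /(_ _ cC); rewrite !setTD.
  - by move=> cF; rewrite preimage_bigcup; have [_ _] := sT; exact.
move=> _ [a ->] /=.
have -> : (tnth (T:=R))^~ k @^-1` `]a, +oo[ = [set x : n.-tuple R | a < tnth x k].
  by apply/seteqP; split=> x /=; rewrite in_itv/= andbT.
exact: trig_indic_ray.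
Qed.

(** A measure on R^n is determined by its images under linear forms: these images
    determine the integrals of the trigonometric functions, and the functions with
    equal integrals are stable under the operations generating their closure,
    which contains all indicators of measurable sets. *)
Theorem cramer_wold_device (mu nu : probability (n.-tuple R) R) :
  (forall c B, measurable B ->
    pushforward mu (linear_form c) B = pushforward nu (linear_form c) B) ->
  forall A, measurable A -> mu A = nu A.
Proof.
move=> munu A mA.
suff : forall f, cl f -> measurable_fun setT f /\
    (\int[mu]_x (f x)%:E = \int[nu]_x (f x)%:E)%E.
  move=> /(_ _ (trig_indic_measurable mA))[_].
  by rewrite !integral_indic// !setIT.
have bint (la : probability (n.-tuple R) R) f : cl f -> measurable_fun setT f ->
    la.-integrable setT (EFin \o f).
  move=> /(bp_closure_bounded trig_bounded)[M M0 fM] mf.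
  apply: measurable_bounded_integrable => //.
    by rewrite -ge0_fin_numE// fin_num_measure.
  by exists M; split; [exact: num_real|move=> N MN x _; exact: le_trans (fM x) (ltW MN)].
move=> f; elim=> [{}f [c [b ->]]|a {}f g cf [mf Hf] cg [mg Hg]|f_ {}f M cf IH fM f_f].
- have ml := measurable_linear_form c.
  have mcos : measurable_fun setT (fun y : R => cos (y + b)).
    apply: measurableT_comp; last exact: measurable_funD.
    by apply: continuous_measurable_fun; exact: continuous_cos.
  have m : measurable_fun setT (fun x => cos (linear_form c x + b)).
    exact: (measurableT_comp mcos ml).
  split=> //.
  pose lc : {mfun n.-tuple R >-> R} := HB.pack (linear_form c)
    (@isMeasurableFun.Build _ _ _ _ (linear_form c) ml).
  have mE : measurable_fun setT (fun y : R => (cos (y + b))%:E) by exact/measurable_EFinP.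
  have key (la : probability (n.-tuple R) R) :
      (\int[la]_x (cos (linear_form c x + b))%:E =
       \int[distribution la lc]_y (cos (y + b))%:E)%E.
    rewrite integral_distribution//; apply: bint => //.
    by apply: bp_base; exists c, b.
  rewrite !key; apply: eq_measure_integral => C mC _; exact: munu.
- have mfg : measurable_fun setT (fun x => a * f x + g x).
    by apply: measurable_funD => //; exact: measurable_funM.
  split=> //.
  have key (la : probability (n.-tuple R) R) :
     (\int[la]_x (a * f x + g x)%:E = a%:E * \int[la]_x (f x)%:E + \int[la]_x (g x)%:E)%E.
    have If := bint la _ cf mf; have Ig := bint la _ cg mg.
    under eq_integral do rewrite EFinD EFinM.
    by rewrite integralD//= ?integralZl//; exact: integrableZl.
  by rewrite !key Hf Hg.
- have mf : measurable_fun setT f.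
    by apply: (measurable_fun_cvg (h := f_)) => [m|x _]; [have [] := IH m|exact: f_f].
  split=> //.
  have key (la : probability (n.-tuple R) R) :
     (\int[la]_x (f_ m x)%:E @[m --> \oo] --> \int[la]_x (f x)%:E)%E.
    apply: (@dominated_cvg _ _ _ la setT measurableT (fun m => EFin \o f_ m) (EFin \o f)
      (cst M%:E)) => //.
    + by move=> m; apply/measurable_EFinP; have [] := IH m.
    + by move=> x _; apply: cvg_EFin; [exact: nearW|exact: f_f].
    + exact: finite_measure_integrable_cst.
    + by move=> m x _ /=; rewrite lee_fin.
  have h1 := key mu; have h2 := key nu.
  have E : (fun m => \int[mu]_x (f_ m x)%:E)%E = (fun m => \int[nu]_x (f_ m x)%:E)%E.
    by apply/funext => m; have [] := IH m.
  by rewrite E in h1; exact: (cvg_unique _ h1 h2).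
Qed.

End cramer_wold.

(** * Moments of Gaussian laws *)

Section normal_moments.
Context {R : realType}.
Local Notation leb := (@lebesgue_measure R).
Implicit Types (m s : R) (g : R -> R).

Lemma ge0_integral_normal_prob m s (f : R -> \bar R) :
  measurable_fun setT f -> (forall x, 0 <= f x)%E ->
  (\int[normal_prob m s]_x f x = \int[leb]_x (f x * (normal_pdf m s x)%:E))%E.
Proof.
move=> mf f0; have dom := normal_prob_dominates m s.
rewrite -(Radon_Nikodym_SigmaFinite.change_of_variables dom)//.
apply: ae_eq_integral => //.
- apply: emeasurable_funM => //; apply: (measurable_int leb).
  exact: Radon_Nikodym_SigmaFinite.f_integrable.
- by apply: emeasurable_funM => //; apply/measurable_EFinP; exact: measurable_normal_pdf.
- apply: ae_eqe_mul2l; apply: integral_ae_eq => //=.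
  + exact: Radon_Nikodym_SigmaFinite.f_integrable.
  + by apply/measurable_EFinP; exact: measurable_normal_pdf.
  + by move=> E _ mE; rewrite -Radon_Nikodym_SigmaFinite.f_integral.
Qed.

Lemma normal_pdf_norm m s : normal_pdf m s = normal_pdf m `|s|.
Proof.
apply/funext => x; rewrite /normal_pdf normr_eq0; case: ifP => // _.
by rewrite /normal_peak /normal_fun real_normK// num_real.
Qed.

Lemma normal_prob_norm m s B : normal_prob m s B = normal_prob m `|s| B.
Proof. by rewrite /normal_prob normal_pdf_norm. Qed.

Lemma normal_pdf_affine m s y : 0 < s ->
  normal_pdf m s (m + s * y) * s = normal_pdf 0 1 y.
Proof.
move=> s0; rewrite !normal_pdfE ?gt_eqF//.
rewrite /normal_peak /normal_fun subr0 expr1n mul1r mulrAC; congr (_ * expR _).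
  rewrite -mulrnAr sqrtrM ?sqr_ge0// sqrtr_sqr ger0_norm ?ltW// invfM.
  by rewrite mulrAC mulVf ?mul1r// gt_eqF.
have -> : m + s * y - m = s * y by ring.
by rewrite -(mulr_natr (s ^+ 2)); field; rewrite gt_eqF.
Qed.

Lemma ge0_integral_affine m s g : 0 < s -> continuous g -> (forall x, 0 <= g x) ->
  (\int[leb]_x (g x)%:E = \int[leb]_y (g (m + s * y) * s)%:E)%E.
Proof.
move=> s0 cg g0; pose F (x : R^o) : R^o := m + s * x.
have F' : F^`()%classic = cst s.
  apply/funext => x; rewrite /F derive1E deriveD// derive_cst add0r.
  by rewrite deriveM// derive_cst scaler0 addr0 derive_id scaler1.
rewrite (@increasing_ge0_integration_by_substitutionT _ F)//.
- by apply: eq_integral => x _; rewrite F'.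
- by move=> x y xy; rewrite /F ltrD2l ltr_pM2l.
- by rewrite F' => ?; exact: cvg_cst.
- by rewrite F'; exact: is_cvg_cst.
- by rewrite F'; exact: is_cvg_cst.
- rewrite /F; apply: (@cvg_trans _ ((fun x => x + m) \o (fun x => s * x) @ -oo)).
    by apply: near_eq_cvg; near=> x; rewrite /= addrC.
  apply: cvg_comp; last exact: cvg_addrr_Ny.
  by apply: gt0_cvgMrNy => //; exact: cvg_id.
- rewrite /F; apply: (@cvg_trans _ ((fun x => x + m) \o (fun x => s * x) @ +oo)).
    by apply: near_eq_cvg; near=> x; rewrite /= addrC.
  apply: cvg_comp; last exact: cvg_addrr.
  by apply: gt0_cvgMry => //; exact: cvg_id.
Unshelve. all: end_near. Qed.

(** The reflection exchanges the two half-lines, on each of which the change of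
    variables is monotone. *)
Lemma ge0_integral_opp g : continuous g -> (forall x, 0 <= g x) ->
  (\int[leb]_x (g x)%:E = \int[leb]_y (g (- y))%:E)%E.
Proof.
move=> cg g0.
have split (h : R -> R) : continuous h -> (forall x, 0 <= h x) ->
    (\int[leb]_x (h x)%:E = \int[leb]_(x in `]-oo, (- 0)%R]) (h x)%:E +
                            \int[leb]_(x in `[(0 : R)%R, +oo[) (h x)%:E)%E.
  move=> ch h0; have mh : measurable_fun setT h by exact: continuous_measurable_fun.
  rewrite -integral_itv_obnd_cbnd; last exact/measurable_EFinP/measurable_funTS.
  rewrite -ge0_integral_setU//= ?oppr0.
  - by rewrite -setCitvr setvU.
  - by rewrite -setCitvr setvU; exact/measurable_EFinP.
  - by move=> x _; rewrite lee_fin.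
  - rewrite disj_set2E; apply/eqP; rewrite -subset0 => x/=.
    by rewrite !in_itv/= andbT ltNge => -[-> /negP].
have cgN : continuous (g \o -%R).
  by move=> x; apply: continuous_comp; [exact: opp_continuous|exact: cg].
have gN0 x : 0 <= (g \o -%R) x by exact: g0.
rewrite (split g cg g0) (split _ cgN gN0) addeC.
rewrite ge0_integration_by_substitutionNy//; last exact: continuous_subspaceT.
congr (_ + _)%E.
rewrite ge0_integration_by_substitutionNy//; last exact: continuous_subspaceT.
by apply: eq_integral => x _ /=; rewrite opprK.
Qed.

Lemma ge0_integral_normal_affine m s g : 0 < s -> continuous g ->
  (forall x, 0 <= g x) ->
  (\int[normal_prob m s]_x (g x)%:E = \int[normal_prob 0 1]_y (g (m + s * y))%:E)%E.
Proof.
move=> s0 cg g0; have mg := continuous_measurable_fun cg.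
have cpdf : continuous (normal_pdf m s) by apply: continuous_normal_pdf; rewrite gt_eqF.
rewrite ge0_integral_normal_prob; [|exact/measurable_EFinP|by move=> x; rewrite lee_fin].
rewrite ge0_integral_normal_prob; last first.
- by move=> x; rewrite lee_fin.
- apply/measurable_EFinP; apply: measurableT_comp => //.
  by apply: measurable_funD => //; exact: measurable_funM.
under eq_integral do rewrite -EFinM.
rewrite (@ge0_integral_affine m s (fun x => g x * normal_pdf m s x))//.
- by apply: eq_integral => y _; rewrite -mulrA normal_pdf_affine// EFinM.
- by move=> x; apply: cvgM; [exact: cg|exact: cpdf].
- by move=> x; rewrite mulr_ge0// normal_pdf_ge0.
Qed.

Lemma ge0_integral_std_normal_opp g : continuous g -> (forall x, 0 <= g x) ->
  (\int[normal_prob 0 1]_x (g x)%:E = \int[normal_prob 0 1]_y (g (- y))%:E)%E.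
Proof.
move=> cg g0; have mg := continuous_measurable_fun cg.
have cpdf : continuous (@normal_pdf R 0 1) by exact: continuous_normal_pdf.
rewrite ge0_integral_normal_prob; [|exact/measurable_EFinP|by move=> x; rewrite lee_fin].
rewrite ge0_integral_normal_prob; last first.
- by move=> x; rewrite lee_fin.
- by apply/measurable_EFinP; exact: measurableT_comp.
under eq_integral do rewrite -EFinM.
rewrite (@ge0_integral_opp (fun x => g x * normal_pdf 0 1 x)).
- apply: eq_integral => y _; rewrite EFinM; congr (_ * _%:E)%E.
  by rewrite !normal_pdfE// /normal_fun !subr0 sqrrN.
- by move=> x; apply: cvgM; [exact: cg|exact: cpdf].
- by move=> x; rewrite mulr_ge0// normal_pdf_ge0.
Qed.

(** Moments of the standard normal law, left unevaluated: variances are measured in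
    units of normal_moment 1 throughout. *)
Definition normal_moment (p : nat) : R :=
  fine (\int[normal_prob 0 1]_y (y ^+ p.*2)%:E)%E.

(** Finite because exp (x^2/4) dominates x^(2p) up to a constant, which leaves the
    integrable weight exp (-x^2/4), proportional to a normal density with
    variance 2. *)
Lemma normal_moment_fin p : (0 < p)%N ->
  (\int[normal_prob (0:R) 1]_y (y ^+ p.*2)%:E)%E = (normal_moment p)%:E.
Proof.
move=> p0; rewrite fineK// ge0_fin_numE; last first.
  by apply: integral_ge0 => x _; rewrite lee_fin exprn_even_ge0.
rewrite ge0_integral_normal_prob//; last 2 first.
- by apply/measurable_EFinP; exact: exprn_measurable.
- by move=> x; rewrite lee_fin exprn_even_ge0.
have s20 : Num.sqrt 2%:R != 0 :> R by rewrite gt_eqF// sqrtr_gt0.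
pose C : R := p`!%:R * 4%:R ^+ p * normal_peak 1 / normal_peak (Num.sqrt 2%:R).
have C0 : 0 <= C.
  by rewrite /C !mulr_ge0 ?invr_ge0 ?normal_peak_ge0// exprn_ge0.
apply: (@le_lt_trans _ _ (\int[leb]_x (C%:E * (normal_pdf 0 (Num.sqrt 2%:R) x)%:E))%E).
  apply: ge0_le_integral => //.
  - by move=> x _; rewrite lee_fin mulr_ge0 ?exprn_even_ge0// normal_pdf_ge0.
  - apply/measurable_EFinP; apply: measurable_funM; first exact: exprn_measurable.
    exact: measurable_normal_pdf.
  - by apply: measurable_funeM; apply/measurable_EFinP; exact: measurable_normal_pdf.
  move=> x _; rewrite lee_fin !normal_pdfE// /C.
  rewrite [X in _ <= X](_ : _ = normal_peak 1 *
      (p`!%:R * 4%:R ^+ p * normal_fun 0 (Num.sqrt 2%:R) x)); last first.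
    by field; rewrite gt_eqF// normal_peak_gt0.
  rewrite mulrCA ler_wpM2l ?normal_peak_ge0//.
  rewrite /normal_fun subr0 expr1n sqr_sqrtr//.
  have -> : expR (- x ^+ 2 / (1 *+ 2)) =
            expR (- x ^+ 2 / (2%:R *+ 2)) * expR (- (x ^+ 2 / 4%:R)).
    by rewrite -expRD; congr expR; field.
  rewrite mulrCA [X in _ <= X]mulrC ler_wpM2l ?expR_ge0//.
  rewrite expRN ler_pdivrMr ?expR_gt0//.
  have := @expR_ge1Dxn R (x ^+ 2 / 4%:R) p.-1.
  rewrite prednK// => /(_ _)/(le_trans _) h.
  have {}h : (x ^+ 2 / 4%:R) ^+ p / p`!%:R <= expR (x ^+ 2 / 4%:R).
    by apply: h; [rewrite lerDr|rewrite mulr_ge0// sqr_ge0].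
  rewrite (_ : x ^+ p.*2 = p`!%:R * 4%:R ^+ p * ((x ^+ 2 / 4%:R) ^+ p / p`!%:R)).
    by rewrite ler_wpM2l// mulr_ge0// exprn_ge0.
  rewrite -muln2 mulnC exprM expr_div_n; field.
  by rewrite expf_neq0//= pnatr_eq0 -lt0n fact_gt0.
rewrite ge0_integralZl//; last first.
- by move=> x _; rewrite lee_fin normal_pdf_ge0.
- by apply/measurable_EFinP; exact: measurable_normal_pdf.
by rewrite integral_normal_pdf mule1 ltry.
Qed.

Lemma normal_moment_ge0 p : 0 <= normal_moment p.
Proof.
by apply: fine_ge0; apply: integral_ge0 => x _; rewrite lee_fin exprn_even_ge0.
Qed.

(** If the second moment vanished, the normal law would be concentrated at 0, a
    Lebesgue null set, contradicting absolute continuity. *)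
Lemma normal_moment1_gt0 : 0 < normal_moment 1.
Proof.
rewrite lt_neqAle eq_sym normal_moment_ge0 andbT.
apply/negP => /eqP k0; have := @normal_moment_fin 1 isT; rewrite k0.
have mE : measurable_fun [set: R] (fun y => (y ^+ 1.*2)%:E).
  by apply/measurable_EFinP; exact: exprn_measurable.
move=> I0.
have : ae_eq (normal_prob 0 1) setT (fun y : R => (y ^+ 1.*2)%:E) (cst 0%E).
  apply/ae_eq_integral_abs => //.
  by rewrite -[RHS]I0; apply: eq_integral => x _; rewrite gee0_abs// lee_fin exprn_even_ge0.
move=> [N [mN N0 sub]].
have : normal_prob (0:R) 1 setT = 0%E.
  apply/eqP; rewrite eq_le measure_ge0 andbT.
  have -> : [set: R] = [set 0] `|` ~` [set 0] by rewrite setUv.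
  apply: (le_trans (measureU2 _ _ _)) => //; first exact: measurableC.
  rewrite -[X in (_ <= X)%E]adde0; apply: leeD.
    rewrite le_eqVlt; apply/orP; left; apply/eqP.
    have /null_content_dominatesP := @normal_prob_dominates R 0 1.
    by apply => //; exact: (lebesgue_measure_set1 0).
  rewrite -N0; apply: le_measure; rewrite ?inE//; first exact: measurableC.
  move=> y y0; apply: sub => /= /(_ I) => -[] /eqP.
  by rewrite expf_eq0/= => /eqP.
by rewrite probability_setT => /eqP; rewrite onee_eq0.
Qed.

End normal_moments.

Section gaussian_rv.
Context d (T : measurableType d) (R : realType) (P : probability T R).
Variables (X : {RV P >-> R}) (m s : R).
Hypothesis lawX : forall B : set R, measurable B -> pushforward P X B = gaussian_law m s B.

(** X has the law of m + |s| N with N standard normal, including when s = 0. *)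
Lemma gaussian_ge0_integral (g : R -> R) : continuous g -> (forall x, 0 <= g x) ->
  (\int[P]_w (g (X w))%:E = \int[normal_prob 0 1]_y (g (m + `|s| * y))%:E)%E.
Proof.
move=> cg g0; have mg := continuous_measurable_fun cg.
(* normal_prob lives on the sigma-algebra generated by half-open intervals; X is
   repackaged with that codomain so that its distribution can be compared *)
have mX : measurable_fun setT (X : T -> measurableTypeR R).
  by have := measurable_funPT X.
pose Y : {mfun T >-> measurableTypeR R} :=
  HB.pack (X : T -> measurableTypeR R) (isMeasurableFun.Build _ _ _ _ _ mX).
have mgE : measurable_fun [set: measurableTypeR R] (fun y : R => (g y)%:E).
  exact/measurable_EFinP.
have -> : (\int[P]_w (g (X w))%:E = \int[distribution P Y]_y (g y)%:E)%E.
  by rewrite (ge0_integral_distribution Y mgE)// => x; rewrite lee_fin.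
have [s0|s0] := eqVneq s 0.
  rewrite s0 normr0; under [RHS]eq_integral do rewrite mul0r addr0.
  rewrite integral_cst// [X in (_ * X)%E](_ : _ = 1%E); last exact: probability_setT.
  rewrite mule1 (eq_measure_integral (dirac (m : measurableTypeR R))).
    by rewrite integral_dirac// diracT mul1e.
  by move=> A mA _; apply: etrans (lawX mA) _; rewrite /gaussian_law s0 eqxx.
rewrite -(ge0_integral_normal_affine _ _ cg)// ?normr_gt0//.
apply: eq_measure_integral => A mA _; apply: etrans (lawX mA) _.
by rewrite /gaussian_law (negPf s0) normal_prob_norm.
Qed.

Lemma gaussian_moment p : (0 < p)%N ->
  (\int[P]_w ((X w - m) ^+ p.*2)%:E = (s ^+ p.*2 * normal_moment p)%:E)%E.
Proof.
move=> p0; rewrite (@gaussian_ge0_integral (fun x => (x - m) ^+ p.*2)); last 2 first.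
- move=> x; apply: (@continuous_comp _ _ _ (fun x => x - m) (fun x => x ^+ p.*2)).
    by apply: cvgB; [exact: cvg_id|exact: cvg_cst].
  exact: exprn_continuous.
- by move=> x; exact: exprn_even_ge0.
rewrite EFinM -normal_moment_fin// -ge0_integralZl//=; last first.
- by rewrite lee_fin exprn_even_ge0.
- by move=> x _; rewrite lee_fin exprn_even_ge0.
- by apply/measurable_EFinP; exact: exprn_measurable.
apply: eq_integral => y _; rewrite -EFinM; congr EFin.
by rewrite addrC addKr exprMn -!muln2 mulnC !exprM real_normK// num_real.
Qed.

(** By symmetry of the standard normal law the positive and negative parts of
    X - m have the same integral. *)
Lemma gaussian_mean : (X : T -> R) \in Lfun P 1 -> ('E_P[X] = m%:E)%E.
Proof.
move=> X1; have iX := (Lfun1_integrable _ _).1 X1.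
have imB : P.-integrable setT (fun w => (X w - m)%:E).
  under eq_fun do rewrite EFinB.
  by apply: integrableB => //; exact: finite_measure_integrable_cst.
pose g x : R := Num.max (x - m) 0; pose h x : R := Num.max (- (x - m)) 0.
have cB : continuous (fun x : R => x - m).
  by move=> x; apply: cvgB; [exact: cvg_id|exact: cvg_cst].
have cg : continuous g.
  by move=> x; apply: (@continuous_max _ _ (fun x => x - m) (cst 0)); [exact: cB|exact: cvg_cst].
have ch : continuous h.
  by move=> x; apply: (@continuous_max _ _ (fun x => - (x - m)) (cst 0)); [apply: cvgN; exact: cB|exact: cvg_cst].
have gh : (\int[P]_w (g (X w))%:E = \int[P]_w (h (X w))%:E)%E.
  rewrite !gaussian_ge0_integral//; last 2 first.
  - by move=> x; rewrite le_max lexx orbT.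
  - by move=> x; rewrite le_max lexx orbT.
  rewrite (@ge0_integral_std_normal_opp _ (fun y => g (m + `|s| * y))).
  - apply: eq_integral => y _; congr (_%:E); rewrite /g /h; congr (Num.max _ _); ring.
  - move=> x; apply: (@continuous_comp _ _ _ (fun y => m + `|s| * y) g); last exact: cg.
    apply: cvgD; first exact: cvg_cst.
    by apply: cvgM; [exact: cvg_cst|exact: cvg_id].
  - by move=> x; rewrite le_max lexx orbT.
have I0 : (\int[P]_w (X w - m)%:E = 0)%E.
  rewrite integralE.
  have -> : (\int[P]_w ((fun w => (X w - m)%:E)^\+ w) = \int[P]_w (g (X w))%:E)%E.
    by apply: eq_integral => w _; rewrite unlock /g EFin_max.
  have -> : (\int[P]_w ((fun w => (X w - m)%:E)^\- w) = \int[P]_w (h (X w))%:E)%E.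
    by apply: eq_integral => w _; rewrite unlock /h EFin_max.
  rewrite gh subee//.
  have := integrable_fin_num measurableT (integrable_funeneg measurableT imB).
  congr (_ \is a fin_num).
  by apply: eq_integral => w _; rewrite unlock /h EFin_max.
rewrite expectation_def.
have -> : (\int[P]_w (X w)%:E = \int[P]_w ((X w - m)%:E + m%:E))%E.
  by apply: eq_integral => w _; rewrite -EFinD subrK.
rewrite integralD//; last exact: finite_measure_integrable_cst.
by rewrite I0 add0e integral_cst//= probability_setT mule1.
Qed.

End gaussian_rv.

(** * Centered Gaussian processes *)

Section centered_gaussian_processes.
Context d (T : measurableType d) (R : realType) (P : probability T R).

Lemma gaussian_law_sqr (s s' : R) B : s ^+ 2 = s' ^+ 2 ->
  gaussian_law 0 s B = gaussian_law 0 s' B.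
Proof.
move=> ss; have n : `|s| = `|s'| by rewrite -!sqrtr_sqr ss.
have s0 : (s == 0) = (s' == 0) by rewrite -normr_eq0 n normr_eq0.
rewrite /gaussian_law s0; case: ifP => [//|_].
by rewrite normal_prob_norm n -normal_prob_norm.
Qed.

(** The Cramer-Wold device for random vectors. *)
Lemma eq_joint_law n (X Y : 'I_n -> {RV P >-> R}) :
  (forall (a : 'I_n -> R) (C : set R), measurable C ->
    pushforward P (fun w => \sum_(k < n) a k * X k w) C =
    pushforward P (fun w => \sum_(k < n) a k * Y k w) C) ->
  forall B : set (n.-tuple R), measurable B ->
    pushforward P (fun w => [tuple X k w | k < n]) B =
    pushforward P (fun w => [tuple Y k w | k < n]) B.
Proof.
move=> XY B mB.
have mt (V : 'I_n -> {RV P >-> R}) : measurable_fun setT (fun w => [tuple V k w | k < n]).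
  apply/measurable_fun_tnthP => k.
  rewrite (_ : _ \o _ = V k); first exact: measurable_funPT.
  by apply/funext => w /=; rewrite tnth_mktuple.
pose tp (V : 'I_n -> {RV P >-> R}) : {mfun T >-> n.-tuple R} := HB.pack (fun w => [tuple V k w | k < n])
  (@isMeasurableFun.Build _ _ _ _ _ (mt V)).
apply: (@cramer_wold_device R n (distribution P (tp X)) (distribution P (tp Y))) => // a C mC.
have lf (V : 'I_n -> {RV P >-> R}) : linear_form a \o tp V = fun w => \sum_(k < n) a k * V k w.
  apply/funext => w; rewrite /linear_form /=.
  by apply: eq_bigr => k _; rewrite tnth_mktuple.
have key (V : 'I_n -> {RV P >-> R}) : pushforward (distribution P (tp V)) (linear_form a) C =
    pushforward P (fun w => \sum_(k < n) a k * V k w) C by rewrite -lf.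
by rewrite !key; exact: XY.
Qed.

Variables (X : R -> {RV P >-> R}) (K : R -> R -> R).
Hypotheses (gX : gaussian_process X) (cX : centered X).
Hypothesis X2 : forall u, (X u : T -> R) \in Lfun P 2%:E.
Hypothesis covX : forall u v, (\int[P]_w (X u w * X v w)%:E = (K u v)%:E)%E.

Lemma Lfun2_Lfun1 u : (X u : T -> R) \in Lfun P 1.
Proof. by apply: Lfun_subset12 (X2 u); rewrite fin_num_measure. Qed.

Lemma integrable_mul u v : P.-integrable setT (fun w => (X u w * X v w)%:E).
Proof. by apply/Lfun1_integrable; exact: Lfun2_mul_Lfun1 (X2 u) (X2 v). Qed.

Lemma centered_covariance u v : covariance P (X u) (X v) = (K u v)%:E.
Proof.
rewrite covarianceE; [|exact: Lfun2_Lfun1..|].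
  by rewrite !cX mule0 sube0 unlock; exact: covX.
by apply/Lfun1_integrable; exact: integrable_mul.
Qed.

(** The law is normal by joint Gaussianity; its first two moments identify the
    parameters.  The variance is recorded up to the factor normal_moment 1. *)
Lemma linear_combination_law n (u : 'I_n -> R) (a : 'I_n -> R) : exists s : R,
  (forall B : set R, measurable B ->
    pushforward P (fun w => \sum_(k < n) a k * X (u k) w) B = gaussian_law 0 s B) /\
  s ^+ 2 * normal_moment 1 = \sum_(i < n) \sum_(j < n) a i * a j * K (u i) (u j).
Proof.
have [m [s law]] : exists m s, forall B : set R, measurable B ->
    pushforward P (fun w => \sum_(k < n) a k * X (u k) w) B = gaussian_law m s B.
  exact: gX.
pose S w : R := \sum_(k < n) a k * X (u k) w.
have mS : measurable_fun setT S.
  by apply: measurable_sum => k; apply: measurable_funM.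
pose Y : {RV P >-> R} := HB.pack S (@isMeasurableFun.Build _ _ _ _ S mS).
have lawY (B : set R) : measurable B -> pushforward P Y B = gaussian_law m s B := law B.
have iaX k : P.-integrable setT (fun w => (a k * X (u k) w)%:E).
  under eq_fun do rewrite EFinM.
  by apply: integrableZl => //; apply/Lfun1_integrable; exact: Lfun2_Lfun1.
have iS : P.-integrable setT (fun w => (S w)%:E).
  by under eq_fun do rewrite /S -sumEFin; apply: integrable_sum.
have ES : (\int[P]_w (S w)%:E = 0)%E.
  under eq_integral do rewrite /S -sumEFin.
  rewrite integral_sum//.
  apply: big1 => k _; under eq_integral do rewrite EFinM.
  rewrite integralZl//; last by apply/Lfun1_integrable; exact: Lfun2_Lfun1.
  by have := cX (u k); rewrite unlock => ->; rewrite mule0.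
have m0 : m = 0.
  have Y1 : (Y : T -> R) \in Lfun P 1 by apply/Lfun1_integrable.
  by have := gaussian_mean lawY Y1; rewrite expectation_def ES => -[].
exists s; split=> [B mB|]; first by rewrite -[in RHS]m0; exact: law.
have := @gaussian_moment _ _ _ _ Y m s lawY 1 isT.
move=> /(congr1 fine)/= <-; rewrite m0 -[RHS]/(fine _%:E); congr fine.
transitivity (\int[P]_w (\sum_(i < n) \sum_(j < n)
   (a i * a j)%:E * (X (u i) w * X (u j) w)%:E))%E.
  apply: eq_integral => w _; rewrite subr0 expr2 /S mulr_suml -sumEFin.
  apply: eq_bigr => i _; rewrite mulr_sumr -sumEFin; apply: eq_bigr => j _.
  by rewrite -EFinM mulrACA.
have iXX i j : P.-integrable setT (fun w => ((a i * a j)%:E * (X (u i) w * X (u j) w)%:E)%E).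
  by apply: integrableZl => //; exact: integrable_mul.
rewrite integral_sum//; last by move=> i; apply: integrable_sum.
rewrite -sumEFin; apply: eq_bigr => i _.
rewrite integral_sum// -sumEFin; apply: eq_bigr => j _.
by rewrite integralZl//; [rewrite covX|exact: integrable_mul].
Qed.

(** Shifting time leaves the variance of every linear combination unchanged, hence
    its law, hence by Cramer-Wold the joint laws. *)
Theorem shift_invariant_stationary :
  (forall u v h, K (u + h) (v + h) = K u v) -> stationary X.
Proof.
move=> Kh n u h; apply: (@eq_joint_law n (fun k => X (u k + h)) (fun k => X (u k))).
move=> a C mC.
have [s [law hs]] := linear_combination_law (fun k => u k + h) a.
have [s' [law' hs']] := linear_combination_law u a.
apply: etrans (law _ mC) _; apply: etrans _ (esym (law' _ mC)).
apply: gaussian_law_sqr.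
apply: (mulIf (lt0r_neq0 (normal_moment1_gt0 (R := R)))); rewrite hs hs'.
by apply: eq_bigr => i _; apply: eq_bigr => j _; rewrite Kh.
Qed.

(** Gaussian increments have moments of every even order controlled by the
    corresponding power of their variance. *)
Lemma increment_moments (L : R) :
  (forall u v, K u u - K u v - K v u + K v v <= L * `|u - v|) ->
  forall p, (0 < p)%N -> exists C : R, forall u v,
    (\int[P]_w ((X u w - X v w) ^+ p.*2)%:E <= (C * `|u - v| ^+ p)%:E)%E.
Proof.
move=> KL p p0; pose k1 : R := normal_moment 1.
have k10 : 0 < k1 by exact: normal_moment1_gt0.
exists ((L / k1) ^+ p * normal_moment p) => u v.
pose x (k : 'I_2) : R := if k == 0 then u else v.
pose a (k : 'I_2) : R := if k == 0 then 1 else -1.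
have [s [law hs]] := linear_combination_law x a.
have XE : (fun w => \sum_(k < 2) a k * X (x k) w) = (fun w => X u w - X v w).
  by apply/funext => w; rewrite !big_ord_recl big_ord0 /a /x /= mul1r mulN1r addr0.
rewrite {}XE in law.
have mX : measurable_fun setT (fun w => X u w - X v w) by apply: measurable_funB.
pose Y : {RV P >-> R} := HB.pack (fun w => X u w - X v w)
  (@isMeasurableFun.Build _ _ _ _ _ mX).
have lawY (B : set R) : measurable B -> pushforward P Y B = gaussian_law 0 s B := law B.
have := @gaussian_moment _ _ _ _ Y 0 s lawY p p0.
under eq_integral do rewrite subr0.
move=> h; apply: (@le_trans _ _ (s ^+ p.*2 * normal_moment p)%:E).
  by rewrite -h.
rewrite lee_fin.
rewrite mulrAC ler_wpM2r ?normal_moment_ge0// -exprMn -mul2n exprM.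
have sE : s ^+ 2 * k1 <= L * `|u - v|.
  apply: le_trans (KL u v); rewrite hs !big_ord_recl !big_ord0 /a /x /=.
  by rewrite le_eqVlt; apply/orP; left; apply/eqP; ring.
have sL : s ^+ 2 <= L / k1 * `|u - v| by rewrite mulrAC ler_pdivlMr.
by apply: lerXn2r; rewrite ?nnegrE ?sqr_ge0// (le_trans _ sL)// sqr_ge0.
Qed.

End centered_gaussian_processes.

(** * The covariance of the kernels *)

Lemma sqr_integrable_Lfun2 d (T : measurableType d) (R : realType)
    (mu : {measure set T -> \bar R}) (f : T -> R) : measurable_fun setT f ->
  (\int[mu]_x (f x ^+ 2)%:E < +oo)%E -> f \in Lfun mu 2%:E.
Proof.
move=> mf foo; rewrite inE; apply/andP; split; rewrite inE//=.
rewrite /finite_norm unlock; apply: poweR_lty; apply: le_lt_trans foo.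
rewrite le_eqVlt; apply/orP; left; apply/eqP; apply: eq_integral => x _ /=.
by rewrite powR_mulrn// real_normK// num_real.
Qed.

Section gumbel.
Context {R : realType}.
Implicit Types u v w x y : R.

Definition gumbel_cdf u x : R := expR (- expR (- (x - u))).

Definition gumbel_quantile y : R := - ln (- ln y).

Lemma gumbel_cdf_gt0 u x : 0 < gumbel_cdf u x.
Proof. exact: expR_gt0. Qed.

Lemma gumbel_cdf_lt1 u x : gumbel_cdf u x < 1.
Proof. by rewrite /gumbel_cdf -expR0 ltr_expR oppr_lt0 expR_gt0. Qed.

Lemma le_gumbel_cdf u v x : u <= v -> gumbel_cdf v x <= gumbel_cdf u x.
Proof. by move=> uv; rewrite /gumbel_cdf ler_expR lerN2 ler_expR; lra. Qed.

(** Max-stability: the maximum of independent Gumbel variables is again Gumbel. *)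
Lemma gumbel_cdfM u v x :
  gumbel_cdf u x * gumbel_cdf v x = gumbel_cdf (ln (expR u + expR v)) x.
Proof.
rewrite /gumbel_cdf -expRD; congr expR.
rewrite -opprD; congr (- _).
rewrite !opprB !expRD lnK ?posrE ?addr_gt0 ?expR_gt0//.
by rewrite mulrDl.
Qed.

Lemma le_gumbel_cdf_quantile u x y : 0 < y < 1 ->
  (y <= gumbel_cdf u x) = (gumbel_quantile y + u <= x).
Proof.
move=> /andP[y0 y1].
have ly : 0 < - ln y by rewrite oppr_gt0 ln_lt0// y0.
rewrite /gumbel_cdf /gumbel_quantile -[X in X <= _](lnK y0) ler_expR.
rewrite lerNr -[X in _ <= X](lnK ly) ler_expR.
by apply/idP/idP; lra.
Qed.

Lemma measurable_gumbel_cdf u : measurable_fun setT (gumbel_cdf u).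
Proof.
rewrite /gumbel_cdf; do 2 (apply: measurableT_comp => //; apply: measurableT_comp => //).
exact: measurable_funB.
Qed.

End gumbel.

Section unit_interval_measure.
Context {R : realType}.
Local Notation leb := (@lebesgue_measure R).

(** Lebesgue measure on [0, 1], kept as a measure on the whole line so that the
    strip measure becomes a product of two measures. *)
Definition unit_lebesgue : set (measurableTypeR R) -> \bar R :=
  mrestr leb (measurable_itv `[0 : R, 1]).

HB.instance Definition _ := Measure.on unit_lebesgue.

Let unit_lebesgueT : unit_lebesgue setT = 1%E.
Proof.
by rewrite /unit_lebesgue /mrestr setTI lebesgue_measure_itv/= lte01 oppr0 adde0.
Qed.

HB.instance Definition _ :=
  Measure_isProbability.Build _ _ R unit_lebesgue unit_lebesgueT.

Lemma unit_lebesgue_ray (a : R) : 0 <= a <= 1 ->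
  unit_lebesgue [set y | y <= a] = a%:E.
Proof.
move=> /andP[a0 a1]; rewrite /unit_lebesgue /mrestr.
rewrite (_ : _ `&` _ = `[0, a]%classic).
  rewrite lebesgue_measure_itv/= lte_fin.
  have [_|a0'] := ltP 0 a; first by rewrite oppr0 adde0.
  by rewrite (le_anti (introT andP (conj a0' a0))).
apply/seteqP; split=> y /=; rewrite !in_itv/=; first by move=> [-> /andP[->]].
by move=> /andP[y0 ya]; split=> //; rewrite y0 (le_trans ya).
Qed.

Lemma unit_lebesgue_oc (a b : R) : 0 <= a -> a <= b -> b <= 1 ->
  unit_lebesgue [set y | a < y <= b] = (b - a)%:E.
Proof.
move=> a0 ab b1; rewrite /unit_lebesgue /mrestr.
rewrite (_ : _ `&` _ = `]a, b]%classic).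
  rewrite lebesgue_measure_itv/= lte_fin.
  have [_|ba] := ltP a b; first by rewrite -EFinB.
  by rewrite (le_anti (introT andP (conj ba ab))) subrr.
apply/seteqP; split=> y /=; rewrite !in_itv/=; first by move=> [].
move=> /andP[ya yb]; rewrite ya yb; split=> //.
by rewrite (ltW (le_lt_trans a0 ya)) (le_trans yb).
Qed.

Lemma unit_lebesgue_oo : unit_lebesgue `]0, 1[%classic = 1%E.
Proof.
rewrite /unit_lebesgue /mrestr setIidl; last first.
  by move=> y /=; rewrite !in_itv/= => /andP[/ltW -> /ltW ->].
by rewrite lebesgue_measure_itv/= lte01 oppr0 adde0.
Qed.

Lemma strip_measureE (A : set (measurableTypeR R * measurableTypeR R)) :
  measurable A -> (leb \x unit_lebesgue)%E A = strip_measure R A.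
Proof.
apply: product_measure_unique => B C mB mC.
rewrite /strip_measure /= /mrestr /strip -setXI setIT product_measure1E//.
exact: measurableI.
Qed.

(** The covariance of two indicators under the uniform law, where the events
    y <= b and y <= a have probabilities b and a and the smaller is their
    intersection. *)
Lemma covariance_rays (a b : R) : 0 <= a -> a <= b -> b <= 1 ->
  (\int[unit_lebesgue]_y ((\1_[set z | (z <= b)%R] y - b) *
     (\1_[set z | (z <= a)%R] y - a))%:E = (a - a * b)%:E)%E.
Proof.
move=> a0 ab b1.
have a01 : 0 <= a <= 1 by rewrite a0 (le_trans ab).
have b01 : 0 <= b <= 1 by rewrite b1 (le_trans a0).
have mray (c : R) : measurable [set z : measurableTypeR R | z <= c].
  by rewrite -set_itvNyc; exact: measurable_itv.
have Eray c : 0 <= c <= 1 ->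
    ('E_unit_lebesgue[\1_[set z : measurableTypeR R | (z <= c)%R]] = c%:E)%E.
  by move=> c01; rewrite expectation_indic//; exact: unit_lebesgue_ray.
have L1 (A : set (measurableTypeR R)) : measurable A -> (\1_A : _ -> R) \in Lfun unit_lebesgue 1.
  by move=> mA; apply/Lfun1_integrable; exact: integrable_indic.
transitivity (covariance unit_lebesgue (\1_[set z : measurableTypeR R | z <= b] : _ -> R)
   (\1_[set z : measurableTypeR R | z <= a] : _ -> R)).
  by rewrite covariance.unlock !Eray // expectation.unlock.
have I1 : (\1_[set z : measurableTypeR R | z <= b] : _ -> R) *
   (\1_[set z : measurableTypeR R | z <= a] : _ -> R) = \1_[set z : measurableTypeR R | z <= a].
  apply: etrans (esym (indicI _ _ _)) _; congr (\1_ _); apply/seteqP; split=> z /=; first by case.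
  by move=> za; split=> //; exact: le_trans ab.
rewrite covarianceE ?I1; [|exact: L1..].
by rewrite !Eray// -EFinM -EFinB mulrC.
Qed.

End unit_interval_measure.

Section Zkernel_covariance.
Context {R : realType}.
Local Notation leb := (@lebesgue_measure R).
Local Notation unif := (@unit_lebesgue R).
Local Notation RR := (measurableTypeR R * measurableTypeR R)%type.

Lemma measurable_gumbel_fst (u : R) : measurable_fun setT (fun q : RR => gumbel_cdf u q.1).
Proof.
by apply: (measurableT_comp (f := gumbel_cdf u)) => //; exact: measurable_gumbel_cdf.
Qed.

Lemma measurable_subgraph (u : R) :
  measurable [set q : RR | q.2 <= gumbel_cdf u q.1].
Proof.
have := @measurable_fun_ler _ RR R setT (fun q => q.2) (fun q => gumbel_cdf u q.1)
  measurable_snd (measurable_gumbel_fst u) measurableT [set true] I.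
by rewrite setTI.
Qed.

Lemma measurable_Zkernel (u : R) : measurable_fun setT (Zkernel u).
Proof.
apply: measurable_funB; last exact: measurable_gumbel_fst.
by apply: measurable_indic; exact: measurable_subgraph.
Qed.

Lemma Zkernel_section (u x y : R) :
  Zkernel u (x, y) = \1_[set z : R | z <= gumbel_cdf u x] y - gumbel_cdf u x.
Proof. by []. Qed.

(** Tonelli on the region between the two graphs: the slice at height y in (0, 1) is
    the interval between the y-quantiles of the two translates, of length w - v. *)
Lemma integral_gumbel_diff (v w : R) : v <= w ->
  (\int[leb]_x (gumbel_cdf v x - gumbel_cdf w x)%:E = (w - v)%:E)%E.
Proof.
move=> vw.
pose D := [set q : RR | gumbel_cdf w q.1 < q.2 <= gumbel_cdf v q.1].
have mD : measurable D.
  rewrite (_ : D = [set q : RR | q.2 <= gumbel_cdf v q.1] `&`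
                   ~` [set q : RR | q.2 <= gumbel_cdf w q.1]).
    by apply: measurableI; [|apply: measurableC]; exact: measurable_subgraph.
  apply/seteqP; split=> q /=; rewrite /D/=.
    by move=> /andP[h1 h2]; split=> //; apply/negP; rewrite -ltNge.
  by move=> [h1 /negP]; rewrite -ltNge => ->.
have mind : measurable_fun setT (fun q : RR => (\1_D q)%:E : \bar R).
  by apply/measurable_EFinP; exact: measurable_indic.
have := @fubini_tonelli _ _ _ _ _ leb unif (fun q => (\1_D q)%:E) mind
  (fun q => _).
move=> /(_ (fun q => ltac:(by rewrite lee_fin))).
have -> : (\int[leb]_x \int[unif]_y (\1_D (x, y))%:E =
           \int[leb]_x (gumbel_cdf v x - gumbel_cdf w x)%:E)%E.
  apply: eq_integral => x _.
  rewrite (_ : (fun y => _) = (fun y => (\1_(xsection D x) y)%:E)); last first.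
    by apply/funext => y; rewrite !indicE mem_xsection.
  rewrite integral_indic//; last exact: measurable_xsection.
  rewrite setIT -unit_lebesgue_oc; [|exact/ltW/gumbel_cdf_gt0|exact: le_gumbel_cdf
     |exact/ltW/gumbel_cdf_lt1].
  by rewrite xsectionE.
move=> ->.
rewrite (_ : (fun y => _) = (fun y => ((w - v)%:E * (\1_(`]0, 1[%classic) y)%:E)%E)); last first.
  apply/funext => y.
  rewrite (_ : (fun x => _) = (fun x => (\1_(ysection D y) x)%:E)); last first.
    by apply/funext => x; rewrite !indicE mem_ysection.
  rewrite integral_indic//; last exact: measurable_ysection.
  rewrite setIT indicE; have [y01|y01] := boolP (y \in `]0, 1[%classic).
    rewrite mule1; move: y01; rewrite inE/= in_itv/= => y01.
    rewrite (_ : ysection D y = `[gumbel_quantile y + v, gumbel_quantile y + w[%classic).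
      rewrite lebesgue_measure_itv/= lte_fin ltrD2l.
      have [_|wv] := ltP v w; first by rewrite -EFinB; congr EFin; ring.
      by rewrite (le_anti (introT andP (conj vw wv))) subrr.
    apply/seteqP; split=> x; rewrite /ysection/= in_itv/= inE /D/=;
      rewrite (ltNge (gumbel_cdf w x)) !le_gumbel_cdf_quantile// -ltNge;
      by move=> /andP[-> ->].
  (* heights outside (0, 1) miss the region: the graphs stay strictly inside *)
  rewrite mule0 (_ : ysection D y = set0) ?measure0//.
  rewrite -subset0 => x; rewrite /ysection/= inE /D/= => /andP[h1 h2].
  move/negP: y01; apply; rewrite inE/= in_itv/=.
  by rewrite (lt_trans (gumbel_cdf_gt0 w x))// (le_lt_trans h2)// gumbel_cdf_lt1.
rewrite ge0_integralZl//; last by rewrite lee_fin subr_ge0.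
  rewrite integral_indic// setIT.
  by apply: etrans (mule1 _); congr (_ * _)%E; exact: unit_lebesgue_oo.
by apply/measurable_EFinP; exact: measurable_indic.
Qed.

Lemma ln_expD (u v : R) : u <= v ->
  ln (expR u + expR v) = v + ln (1 + expR (- `|u - v|)).
Proof.
move=> uv; rewrite ler0_norm ?subr_le0// opprK.
rewrite -{2}(expRK v) -lnM ?posrE ?expR_gt0 ?addr_gt0 ?expR_gt0//.
by rewrite mulrDr mulr1 -expRD addrC; congr (ln (_ + expR _)); ring.
Qed.

Lemma iterated_integral_ZkernelM (u v : R) : u <= v ->
  (\int[leb]_x \int[unif]_y (Zkernel u (x, y) * Zkernel v (x, y))%:E =
   (ln (1 + expR (- `|u - v|)))%:E)%E.
Proof.
move=> uv; pose w := ln (expR u + expR v).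
have vw : v <= w.
  by rewrite /w ln_expD// lerDl ln_ge0// lerDl expR_ge0.
transitivity (\int[leb]_x (gumbel_cdf v x - gumbel_cdf w x)%:E)%E.
  apply: eq_integral => x _; under eq_integral do rewrite !Zkernel_section.
  rewrite covariance_rays; [|exact/ltW/gumbel_cdf_gt0|exact: le_gumbel_cdf
     |exact/ltW/gumbel_cdf_lt1].
  by rewrite mulrC gumbel_cdfM.
rewrite integral_gumbel_diff// /w ln_expD//; congr EFin; ring.
Qed.

(** Tonelli applies since the square is nonnegative; this gives the square
    integrability needed to use Fubini for products of two kernels. *)
Lemma integral_Zkernel_sqr (u : R) :
  (\int[leb \x unif]_p (Zkernel u p ^+ 2)%:E = (ln 2%:R)%:E)%E.
Proof.
rewrite fubini_tonelli1//; last 2 first.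
- by apply/measurable_EFinP; apply: measurable_funX; exact: measurable_Zkernel.
- by move=> p; rewrite lee_fin sqr_ge0.
rewrite -[RHS](_ : (ln (1 + expR (- `|u - u|)))%:E = _).
  by rewrite -iterated_integral_ZkernelM.
by rewrite subrr normr0 oppr0 expR0.
Qed.

Lemma integral_strip (f : RR -> \bar R) :
  (\int[strip_measure R]_p f p = \int[leb \x unif]_p f p)%E.
Proof. by apply: eq_measure_integral => A mA _; rewrite -strip_measureE. Qed.

Lemma Lfun2_Zkernel (u : R) : Zkernel u \in Lfun (strip_measure R) 2%:E.
Proof.
apply: sqr_integrable_Lfun2; first exact: measurable_Zkernel.
by rewrite integral_strip integral_Zkernel_sqr ltry.
Qed.

Theorem integral_ZkernelM (u v : R) :
  (\int[strip_measure R]_p (Zkernel u p * Zkernel v p)%:E =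
   (ln (1 + expR (- `|u - v|)))%:E)%E.
Proof.
wlog uv : u v / u <= v.
  move=> h; have [/h//|/ltW/h] := leP u v.
  by rewrite distrC => <-; apply: eq_integral => p _; rewrite mulrC.
rewrite integral_strip -iterated_integral_ZkernelM//.
rewrite -integral12_prod_meas1//; apply/Lfun1_integrable.
by apply: Lfun2_mul_Lfun1; apply: sqr_integrable_Lfun2 (@measurable_Zkernel _) _;
  rewrite integral_Zkernel_sqr ltry.
Qed.

End Zkernel_covariance.

(** * Kolmogorov's continuity criterion *)

Section dyadic_paths.
Context {R : realType}.

Definition dyadic (n : nat) (i : int) : R := i%:~R / 2 ^+ n.

Definition dyadic_index (n : nat) (u : R) : int := Num.floor (2 ^+ n * u).

Definition dyadic_floor (n : nat) (u : R) : R := dyadic n (dyadic_index n u).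

Let two_gt0 n : 0 < 2 ^+ n :> R. Proof. by rewrite exprn_gt0. Qed.

Lemma dyadicS n i : dyadic n.+1 (2 * i) = dyadic n i.
Proof. by rewrite /dyadic exprS intrM; field; rewrite gt_eqF. Qed.

Lemma dyadic_floor_itv n u : dyadic_floor n u <= u < dyadic_floor n u + 2^-1 ^+ n.
Proof.
rewrite /dyadic_floor /dyadic exprVn -[X in _ + X]mul1r -mulrDl.
rewrite ler_pdivrMr// ltr_pdivlMr//.
have /andP[] := floor_itv (2 ^+ n * u).
by rewrite intrD [u * _]mulrC => -> ->.
Qed.

(* g plays the role of one path; only its values at dyadic points in [-N, N] enter *)
Variables (g : R -> R) (N : nat) (C r : R).
Hypotheses (C0 : 0 <= C) (r0 : 0 <= r) (r1 : r < 1).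
Hypothesis g_incr : forall n (i : int),
  - (N * 2 ^ n)%:Z <= i < (N * 2 ^ n)%:Z ->
  `|g (dyadic n (i + 1)) - g (dyadic n i)| <= C * r ^+ n.

Let natN n : (N * 2 ^ n)%:Z%:~R = 2 ^+ n * N%:R :> R.
Proof. by rewrite -pmulrn natrM natrX mulrC. Qed.

Lemma dyadic_index_itv n u : - N%:R <= u < N%:R ->
  - (N * 2 ^ n)%:Z <= dyadic_index n u < (N * 2 ^ n)%:Z.
Proof.
move=> /andP[Nu uN]; rewrite /dyadic_index floor_ge_int floor_lt_int.
by rewrite intrN natN -mulrN ler_pM2l// ltr_pM2l// Nu.
Qed.

(** Refining the grid moves the dyadic floor of u by zero or one fine step. *)
Lemma dyadic_floor_step n u : - N%:R <= u < N%:R ->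
  `|g (dyadic_floor n.+1 u) - g (dyadic_floor n u)| <= C * r ^+ n.+1.
Proof.
move=> Nu; have /andP[h1 h2] := dyadic_index_itv n Nu.
set f := dyadic_index n u in h1 h2 *.
have lo : 2 * f <= dyadic_index n.+1 u.
  rewrite /dyadic_index floor_ge_int intrM exprS -mulrA ler_pM2l//.
  exact: floor_le.
have hi : dyadic_index n.+1 u < 2 * (f + 1).
  rewrite /dyadic_index floor_lt_int intrM exprS -mulrA ltr_pM2l//.
  exact: floorD1_gt.
have [e|e] : dyadic_index n.+1 u = 2 * f \/ dyadic_index n.+1 u = 2 * f + 1 by lia.
  by rewrite /dyadic_floor e dyadicS subrr normr0 mulr_ge0// exprn_ge0.
rewrite /dyadic_floor e -(dyadicS n f) g_incr//.
by rewrite expnS; apply/andP; split; nia.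
Qed.

Lemma dyadic_floor_tail n k u : - N%:R <= u < N%:R ->
  `|g (dyadic_floor (n + k) u) - g (dyadic_floor n u)| <= C * r ^+ n / (1 - r).
Proof.
move=> Nu; have r1' : 0 < 1 - r by rewrite subr_gt0.
apply: (@le_trans _ _ (C * r ^+ n * (1 - r ^+ k) / (1 - r))).
  elim: k => [|k IHk].
    by rewrite addn0 subrr normr0 expr0 subrr mulr0 mul0r.
  rewrite addnS; apply: le_trans (ler_distD (g (dyadic_floor (n + k) u)) _ _) _.
  apply: le_trans (lerD (dyadic_floor_step _ Nu) IHk) _.
  have h : C * r ^+ (n + k).+1 <= C * r ^+ (n + k).
    by rewrite ler_wpM2l// exprS ler_piMl ?exprn_ge0// ltW.
  apply: le_trans (lerD h (lexx _)) _.
  rewrite le_eqVlt; apply/orP; left; apply/eqP.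
  by rewrite exprD exprS; field; rewrite gt_eqF.
rewrite ler_pM2r ?invr_gt0// ler_piMr ?mulr_ge0 ?exprn_ge0//.
by rewrite gerBl exprn_ge0.
Qed.

Lemma cvg_dyadic_floor u : - N%:R <= u < N%:R ->
  cvg (g (dyadic_floor n u) @[n --> \oo]).
Proof.
move=> Nu; pose v n := g (dyadic_floor n u).
have cs : cvgn (series (telescope v)).
  apply: normed_cvg; apply: (@series_le_cvg _ _ (geometric (C * r) r)).
  - by move=> n /=.
  - by move=> n; rewrite /= mulr_ge0 ?exprn_ge0// mulr_ge0.
  - move=> n /=; rewrite /telescope /=; apply: le_trans (dyadic_floor_step n Nu) _.
    by rewrite exprS mulrA.
  - by apply: is_cvg_geometric_series; rewrite ger0_norm.
rewrite -[X in cvgn X]/v (_ : v = fun n => v 0%N + series (telescope v) n); last first.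
  by apply/funext => n; exact: eq_sum_telescope.
by apply: is_cvgD => //; exact: is_cvg_cst.
Qed.

Lemma dyadic_chain n (i : int) (k : nat) :
  - (N * 2 ^ n)%:Z <= i -> i + k%:Z <= (N * 2 ^ n)%:Z ->
  `|g (dyadic n (i + k%:Z)) - g (dyadic n i)| <= k%:R * (C * r ^+ n).
Proof.
move=> hi; elim: k => [|k IHk] hk; first by rewrite addr0 subrr normr0 mul0r.
have {}IHk := IHk ltac:(lia).
apply: le_trans (ler_distD (g (dyadic n (i + k%:Z))) _ _) _.
rewrite -natr1 mulrDl mul1r addrC; apply: lerD => //.
have -> : i + k.+1%:Z = (i + k%:Z) + 1 by lia.
apply: g_incr; lia.
Qed.

Lemma dist_lim_dyadic_floor n u : - N%:R <= u < N%:R ->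
  `|limn (fun m => g (dyadic_floor m u)) - g (dyadic_floor n u)| <= C * r ^+ n / (1 - r).
Proof.
move=> Nu; have c := cvg_dyadic_floor Nu.
have h : `|g (dyadic_floor m u) - g (dyadic_floor n u)| @[m --> \oo] -->
   `|limn (fun m => g (dyadic_floor m u)) - g (dyadic_floor n u)|.
  by apply: cvg_norm; apply: cvgB => //; exact: cvg_cst.
rewrite -(cvg_lim _ h)//; apply: limr_le; first by apply/cvg_ex; eexists; exact: h.
near=> m; rewrite -(@subnKC n m); first exact: dyadic_floor_tail.
by near: m; exact: nbhs_infty_ge.
Unshelve. all: end_near. Qed.

(** The first level whose mesh is below 2 D; by minimality D spans few steps of it. *)
Lemma dyadic_scale (D : R) : 0 < D -> D <= (N.*2)%:R -> (0 < N)%N ->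
  exists n, 2^-1 ^+ n < 2 * D /\ 2 ^+ n * D <= (N.*2)%:R.
Proof.
move=> D0 DN N0.
have ex : exists n, 2^-1 ^+ n < 2 * D.
  have : (fun n => 2^-1 ^+ n : R) @ \oo --> 0.
    by apply: cvg_expr; rewrite ger0_norm// invf_lt1// ltr1n.
  move=> /cvgr_lt/(_ (2 * D)); rewrite mulr_gt0// => /(_ isT)[n _ /(_ n (leqnn n))] h.
  by exists n.
exists (ex_minn ex); case: ex_minnP => -[|n] h min; split=> //.
  by rewrite expr0 mul1r.
have h2 : 2 * D <= 2^-1 ^+ n by rewrite leNgt; apply/negP => /min; rewrite ltnn.
apply: (@le_trans _ _ 1); last by rewrite ler1n double_gt0.
by rewrite exprS mulrAC -ler_pdivlMr// div1r -exprVn.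
Qed.

End dyadic_paths.

(** Compare s and t at the level n whose mesh is of the order of |s - t|: the limits
    are within a constant times r^n of their values at level n by summing a
    geometric series, and at level n the dyadic floors of s and t are at most
    2N + 1 steps apart.  Finally r^n = (2^-n)^alpha is of the order of
    |s - t|^alpha. *)
Theorem dyadic_hoelder (R : realType) (g : R -> R) (N : nat) (C alpha : R) :
  0 <= C -> 0 < alpha <= 1 ->
  (forall n (i : int), - (N * 2 ^ n)%:Z <= i < (N * 2 ^ n)%:Z ->
    `|g (dyadic n (i + 1)) - g (dyadic n i)| <= C * (2^-1 `^ alpha) ^+ n) ->
  exists C' : R, forall s t, - N%:R <= s < N%:R -> - N%:R <= t < N%:R ->
    `|limn (fun m => g (dyadic_floor m s)) - limn (fun m => g (dyadic_floor m t))|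
      <= C' * `|s - t| `^ alpha.
Proof.
move=> C0 /andP[a0 a1]; set r := 2^-1 `^ alpha => g_incr.
have r0 : 0 <= r by exact: powR_ge0.
have r1 : r < 1.
  rewrite /r /powR gt_eqF ?invr_gt0// -[X in _ < X]expR0 ltr_expR pmulr_rlt0//.
  by rewrite ln_lt0// invr_gt0 ltr0n invf_lt1// ltr1n.
have r1' : 0 < 1 - r by rewrite subr_gt0.
pose G s := limn (fun m => g (dyadic_floor m s)).
pose A : R := (C / (1 - r)) *+ 2 + (N.*2.+1)%:R * C.
have A0 : 0 <= A by rewrite addr_ge0 ?mulrn_wge0 ?mulr_ge0 ?invr_ge0// ltW.
exists (A * 2 `^ alpha) => s t; rewrite -/(G s) -/(G t).
wlog st : s t / s < t.
  move=> h hs ht; have [st|ts|<-] := ltgtP s t; first exact: h.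
    by rewrite distrC (distrC s); exact: h.
  by rewrite !subrr normr0 mulr_ge0 ?powR_ge0// mulr_ge0 ?powR_ge0.
move=> hs ht; have D0 : 0 < t - s by rewrite subr_gt0.
have N0 : (0 < N)%N.
  rewrite lt0n; apply/eqP => N0; move: hs; rewrite N0 oppr0 => /andP[h1 h2].
  by have := le_lt_trans h1 h2; rewrite ltxx.
have DN : t - s <= (N.*2)%:R.
  rewrite -addnn natrD; move: hs ht => /andP[h1 h2] /andP[h3 h4]; lra.
have [n [n1 n2]] := dyadic_scale D0 DN N0.
have main : `|G s - G t| <= A * r ^+ n.
  have ls := dist_lim_dyadic_floor C0 r0 r1 g_incr n hs.
  have lt := dist_lim_dyadic_floor C0 r0 r1 g_incr n ht.
  have mid : `|g (dyadic_floor n t) - g (dyadic_floor n s)| <= (N.*2.+1)%:R * (C * r ^+ n).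
    have /andP[is1 is2] := dyadic_index_itv n hs.
    have /andP[it1 it2] := dyadic_index_itv n ht.
    have ist : dyadic_index n s <= dyadic_index n t.
      by apply: le_floor; rewrite ler_pM2l ?exprn_gt0// ltW.
    have kk : `|dyadic_index n t - dyadic_index n s|%N%:Z = dyadic_index n t - dyadic_index n s.
      by rewrite gez0_abs// subr_ge0.
    set k := `|_|%N in kk.
    have kN : (k <= N.*2.+1)%N.
      rewrite -(ler_nat R) (pmulrn _ k) kk intrB.
      have := floor_le (2 ^+ n * t); have := floorD1_gt (2 ^+ n * s).
      rewrite intrD -natr1; move: n2; rewrite mulrBr /dyadic_index; lra.
    have -> : dyadic_floor n t = dyadic n (dyadic_index n s + k%:Z).
      by rewrite /dyadic_floor; congr dyadic; rewrite kk addrC subrK.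
    have hk : dyadic_index n s + k%:Z <= (N * 2 ^ n)%:Z.
      by rewrite kk addrC subrK ltW.
    apply: le_trans (dyadic_chain C0 r0 r1 g_incr is1 hk) _.
    by rewrite ler_wpM2r ?ler_nat// mulr_ge0// exprn_ge0.
  have -> : A * r ^+ n = C * r ^+ n / (1 - r) +
     ((N.*2.+1)%:R * (C * r ^+ n) + C * r ^+ n / (1 - r)) by rewrite /A; ring.
  apply: le_trans (ler_distD (g (dyadic_floor n s)) _ _) _; apply: lerD => //.
  apply: le_trans (ler_distD (g (dyadic_floor n t)) _ _) _; apply: lerD => //.
    by rewrite distrC.
  by rewrite distrC.
apply: le_trans main _; rewrite -mulrA ler_wpM2l//.
rewrite distrC ger0_norm ?(ltW D0)// -powRM ?(ltW D0)//.
rewrite /r -powR_mulrn ?powR_ge0// -powRrM mulrC powRrM powR_mulrn ?invr_ge0//.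
apply: ge0_ler_powR; rewrite ?nnegrE ?exprn_ge0 ?invr_ge0 ?mulr_ge0 ?ltW//.
Qed.

Section summable_random_series.
Context d (T : measurableType d) (R : realType) (P : probability T R).

Lemma nneseries_half (M : R) : 0 <= M ->
  (\sum_(n <oo) (M * 2^-1 ^+ n)%:E <= (2 * M)%:E)%E.
Proof.
move=> M0; apply: lime_le.
  by apply: is_cvg_nneseries => n _ _; rewrite lee_fin mulr_ge0 ?exprn_ge0 ?invr_ge0.
apply: nearW => n; rewrite sumEFin lee_fin.
apply: (@le_trans _ _ (2 * M - 2 * M * 2^-1 ^+ n)); last first.
  by rewrite gerBl mulr_ge0 ?exprn_ge0 ?mulr_ge0 ?invr_ge0.
elim: n => [|n IHn]; first by rewrite big_geq// expr0 mulr1 subrr.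
rewrite big_nat_recr//= exprS; apply: le_trans (lerD IHn (lexx _)) _.
by rewrite le_eqVlt; apply/orP; left; apply/eqP; field.
Qed.

(** A Borel-Cantelli argument in expectation: a nonnegative series with finite
    expectation converges almost surely. *)
Lemma ae_summable (a : nat -> T -> R) (M : R) :
  (forall n, measurable_fun setT (a n)) -> (forall n w, 0 <= a n w) ->
  (forall n, (\int[P]_w (a n w)%:E <= (M * 2^-1 ^+ n)%:E)%E) ->
  {ae P, forall w, (\sum_(n <oo) (a n w)%:E < +oo)%E}.
Proof.
move=> ma a0 aM.
have maE n : measurable_fun setT (fun w => (a n w)%:E) by exact/measurable_EFinP.
have S0 w : (0 <= \sum_(n <oo) (a n w)%:E)%E.
  by apply: nneseries_ge0 => n _ _; rewrite lee_fin.
have M0 : 0 <= M.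
  rewrite -lee_fin -[M]mulr1 -(expr0 2^-1); apply: le_trans (aM 0%N).
  by apply: integral_ge0 => w _; rewrite lee_fin.
have iS : P.-integrable setT (fun w => \sum_(n <oo) (a n w)%:E)%E.
  apply/integrableP; split.
    by apply: ge0_emeasurable_sum => // n w _ _; rewrite lee_fin.
  under eq_integral do rewrite gee0_abs//.
  rewrite integral_nneseries//; last by move=> n w _; rewrite lee_fin.
  apply: (@le_lt_trans _ _ (2 * M)%:E); last by rewrite ltry.
  apply: le_trans (nneseries_half M0); apply: lee_nneseries => // n _ _.
  by apply: integral_ge0 => w _; rewrite lee_fin.
have := integrable_ae measurableT iS.
by apply: filterS => w /(_ I); rewrite ge0_fin_numE.
Qed.

Lemma summable_le (b : nat -> R) n : (forall m, 0 <= b m) ->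
  (\sum_(m <oo) (b m)%:E < +oo)%E -> b n <= fine (\sum_(m <oo) (b m)%:E)%E.
Proof.
move=> b0 boo; rewrite -lee_fin fineK; last first.
  by rewrite ge0_fin_numE//; apply: nneseries_ge0 => m _ _; rewrite lee_fin.
apply: (le_trans _ (@nneseries_lim_ge _ _ xpredT 0 n.+1 _)) => [|m _ _]; last by rewrite lee_fin.
rewrite sumEFin lee_fin big_nat_recr//= lerDr.
by apply: sumr_ge0.
Qed.

Lemma summable_cvg0 (b : nat -> R) : (forall m, 0 <= b m) ->
  (\sum_(m <oo) (b m)%:E < +oo)%E -> b m @[m --> \oo] --> 0.
Proof.
move=> b0 boo; apply: cvg_series_cvg_0.
apply: (@nondecreasing_is_cvgn R).
  apply/nondecreasing_seqP => n; rewrite /series/= big_nat_recr//= lerDl//.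
exists (fine (\sum_(m <oo) (b m)%:E)%E) => _ [n _ <-].
rewrite -lee_fin fineK; last first.
  by rewrite ge0_fin_numE//; apply: nneseries_ge0 => m _ _; rewrite lee_fin.
rewrite /series/= -sumEFin; apply: nneseries_lim_ge => m _ _; by rewrite lee_fin.
Qed.

End summable_random_series.

Section kolmogorov_continuity.
Context d (T : measurableType d) (R : realType) (P : probability T R).
Variable Z : R -> {RV P >-> R}.
Hypothesis Z_moments : forall p, (0 < p)%N -> exists K : R, forall u v,
  (\int[P]_w ((Z u w - Z v w) ^+ p.*2)%:E <= (K * `|u - v| ^+ p)%:E)%E.

(** Left endpoint, in units of 2^-n, of the k-th dyadic interval of [-N, N]. *)
Definition dyadic_left (N n k : nat) : int := k%:Z - (N * 2 ^ n)%:Z.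

Definition dyadic_increment N n k w :=
  Z (dyadic n (dyadic_left N n k + 1)) w - Z (dyadic n (dyadic_left N n k)) w.

(** With p = 2 (j + 1), the 2p-th moment of one increment of level n is at most
    K 2^(-2 (j + 1) n), and there are 2 N 2^n of them.  The weight 2^(2 j n)
    leaves an expectation of order 2^-n, which is summable, and boundedness of the
    weighted powers means increments of size 2^(-alpha n) with
    alpha = j / (2 (j + 1)), which tends to 1/2 as j grows. *)
Definition increment_power (N j n : nat) w : R :=
  \sum_(k < N.*2 * 2 ^ n)
    2 ^+ (j.*2 * n) * dyadic_increment N n k w ^+ (j.+1.*2).*2.

Definition regular_points : set T :=
  [set w | forall N j, (\sum_(n <oo) (increment_power N j n w)%:E < +oo)%E].

Lemma measurable_sub_power (u v : R) p :
  measurable_fun setT (fun w => (Z u w - Z v w) ^+ p).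
Proof. by apply: measurable_funX; apply: measurable_funB. Qed.

Lemma measurable_increment_power N j n : measurable_fun setT (increment_power N j n).
Proof.
apply: measurable_sum => k; apply: measurable_funM => //.
exact: measurable_sub_power.
Qed.

Lemma increment_power_ge0 N j n w : 0 <= increment_power N j n w.
Proof. by apply: sumr_ge0 => k _; rewrite mulr_ge0 ?exprn_even_ge0 ?exprn_ge0//. Qed.

Lemma measurable_regular_points : measurable regular_points.
Proof.
rewrite (_ : regular_points = \bigcap_N \bigcap_j
    [set w | (\sum_(n <oo) (increment_power N j n w)%:E < +oo)%E]).
  apply: bigcapT_measurable => N; apply: bigcapT_measurable => j.
  rewrite -[X in measurable X]setTI; apply: emeasurable_fun_infty_o => //.
  apply: ge0_emeasurable_sum => [n w _ _|n _]; first by rewrite lee_fin increment_power_ge0.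
  by apply/measurable_EFinP; exact: measurable_increment_power.
apply/seteqP; split=> w /=; first by move=> h N _ j _; exact: h.
by move=> h N j; exact: (h N I j I).
Qed.

Lemma ae_regular_points : {ae P, forall w, regular_points w}.
Proof.
apply: ae_foralln => N; apply: ae_foralln => j.
have [K ZK] := @Z_moments j.+1.*2 isT.
apply: (@ae_summable _ _ _ _ _ (N.*2%:R * K)).
- by move=> n; exact: measurable_increment_power.
- by move=> n w; exact: increment_power_ge0.
move=> n; rewrite /increment_power.
under eq_integral do rewrite -sumEFin.
rewrite ge0_integral_sum//; last 2 first.
- move=> k; apply/measurable_EFinP; apply: measurable_funM => //.
  exact: measurable_sub_power.
- by move=> k w _; rewrite lee_fin mulr_ge0 ?exprn_even_ge0 ?exprn_ge0//.
apply: (@le_trans _ _ (\sum_(k < N.*2 * 2 ^ n)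
    (2 ^+ (j.*2 * n) * (K * (2^-1 ^+ n) ^+ j.+1.*2))%:E)%E).
  apply: lee_sum => k _; under eq_integral do rewrite EFinM.
  rewrite ge0_integralZl//; last 2 first.
  - by apply/measurable_EFinP; exact: measurable_sub_power.
  - by move=> w _; rewrite lee_fin exprn_even_ge0.
  rewrite EFinM; apply: lee_wpmul2l; first by rewrite lee_fin exprn_ge0.
  apply: le_trans (ZK _ _) _; rewrite lee_fin.
  rewrite (_ : `| _ | = 2^-1 ^+ n)//.
  by rewrite /dyadic intrD mulrDl addrC addKr mul1r exprVn ger0_norm// invr_ge0 exprn_ge0.
rewrite sumEFin lee_fin sumr_const card_ord -[X in X <= _]mulr_natl natrM natrX.
rewrite le_eqVlt; apply/orP; left; apply/eqP.
rewrite exprAC -!exprM.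
have -> : (2 : R) ^+ (j.*2 * n) = (2 ^+ n) ^+ j.*2 by rewrite -exprM mulnC.
rewrite (mulnC _ n) exprM doubleS !exprS !exprVn; field.
by rewrite !expf_neq0.
Qed.

(** Each weighted increment is bounded by the sum s of all of them; taking roots
    gives the rate, for j so large that alpha <= j / (2 (j + 1)). *)
Lemma regular_increment_bound w N (alpha : R) : regular_points w ->
  0 < alpha < 2^-1 -> exists2 C, 0 <= C & forall n (i : int),
    - (N * 2 ^ n)%:Z <= i < (N * 2 ^ n)%:Z ->
    `|Z (dyadic n (i + 1)) w - Z (dyadic n i) w| <= C * (2^-1 `^ alpha) ^+ n.
Proof.
move=> rw /andP[a0 a12].
have [j ja] : exists j : nat, alpha * j.+1.*2%:R <= j%:R.
  have b0 : 0 < 1 - 2 * alpha by lra.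
  exists (Num.truncn (2 * alpha / (1 - 2 * alpha))).+1.
  set m := Num.truncn _.
  have : 2 * alpha / (1 - 2 * alpha) < m.+1%:R by exact: truncnS_gt.
  rewrite ltr_pdivrMr// -addnn natrD -(natr1 m.+1); lra.
have := rw N j; set S := (\sum_(_ <oo) _)%E => Soo.
pose s := fine S; have s0 : 0 <= s.
  by apply: fine_ge0; apply: nneseries_ge0 => n _ _; rewrite lee_fin increment_power_ge0.
have C1 : 1 <= 1 + s by rewrite lerDl.
have C0 : 0 <= 1 + s by rewrite (le_trans _ C1).
(* 1 + s rather than a root of s: it is at least 1, so its powers dominate s *)
exists (1 + s) => // n i /andP[i1 i2].
pose k := `|(i + (N * 2 ^ n)%:Z)%R|%N.
have kE : k%:Z = i + (N * 2 ^ n)%:Z by rewrite /k gez0_abs//; lia.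
have kN : (k < N.*2 * 2 ^ n)%N by rewrite -doubleMl -addnn; lia.
have kl : dyadic_left N n k = i by rewrite /dyadic_left kE addrK.
set D := Z _ w - Z _ w.
have h1 : 2 ^+ (j.*2 * n) * D ^+ (j.+1.*2).*2 <= s.
  apply: le_trans (summable_le n (fun m => increment_power_ge0 N j m w) Soo).
  rewrite /increment_power (bigD1 (Ordinal kN))//= /dyadic_increment kl lerDl.
  by apply: sumr_ge0 => l _; rewrite mulr_ge0 ?exprn_even_ge0 ?exprn_ge0//.
set r := 2^-1 `^ alpha; have r0 : 0 <= r by exact: powR_ge0.
rewrite -(@ler_pXn2r _ (j.+1.*2).*2)//; last first.
  by rewrite nnegrE mulr_ge0 ?exprn_ge0.
have -> : `|D| ^+ (j.+1.*2).*2 = D ^+ (j.+1.*2).*2.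
  by rewrite -[in LHS]normrX ger0_norm// exprn_even_ge0.
apply: (@le_trans _ _ (s * (2^-1 ^+ j.*2) ^+ n)).
  rewrite -exprM exprVn ler_pdivlMr ?exprn_gt0//.
  by rewrite mulrC.
rewrite exprMn; apply: ler_pM => //.
  apply: (@le_trans _ _ (1 + s)); first by rewrite lerDr.
  by rewrite ler_eXnr.
rewrite [X in _ <= X]exprAC; apply: lerXn2r; rewrite ?nnegrE ?exprn_ge0 ?invr_ge0//.
rewrite -[X in X <= _]powR_mulrn ?invr_ge0//.
rewrite -[X in _ <= X]powR_mulrn// /r -powRrM.
apply: ger_powR; first by rewrite invr_gt0 ltr0n/= invf_le1// ler1n.
by rewrite -(addnn j) -(addnn j.+1.*2) !natrD; lra.
Qed.

Lemma regular_cvg w u : regular_points w ->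
  cvg (Z (dyadic_floor n u) w @[n --> \oo]).
Proof.
move=> rw; pose N := (Num.truncn `|u|).+1.
have [C C0 hC] := @regular_increment_bound w N (4%:R^-1) rw ltac:(lra).
have uN : `|u| < N%:R by exact: truncnS_gt.
have r1 : 2^-1 `^ 4%:R^-1 < 1 :> R.
  rewrite /powR gt_eqF ?invr_gt0// -[X in _ < X]expR0 ltr_expR pmulr_rlt0 ?invr_gt0//.
  by rewrite ln_lt0// invr_gt0 ltr0n invf_lt1// ltr1n.
apply: (@cvg_dyadic_floor _ (fun v => Z v w) N C (2^-1 `^ 4%:R^-1)) => //.
by move: uN; rewrite ltr_norml => /andP[/ltW -> ->].
Qed.

(** The indicator makes the limit exist everywhere, so that the result is measurable
    and has Hoelder paths at every point of the probability space. *)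
Definition regularization u w : R :=
  limn (fun n => \1_regular_points w * Z (dyadic_floor n u) w).

Lemma cvg_regularization u w :
  \1_regular_points w * Z (dyadic_floor n u) w @[n --> \oo] --> regularization u w.
Proof.
suff : cvg (\1_regular_points w * Z (dyadic_floor n u) w @[n --> \oo]) by [].
have [rw|rw] := pselect (regular_points w).
  by apply: is_cvgM; [exact: is_cvg_cst|exact: regular_cvg].
apply/cvg_ex; exists 0; apply: cvg_eventually_cst; near=> n.
by rewrite indicE memNset// mul0r.
Unshelve. all: end_near. Qed.

Lemma measurable_regularization u : measurable_fun setT (regularization u).
Proof.
apply: (measurable_fun_cvg
  (h := fun n w => \1_regular_points w * Z (dyadic_floor n u) w)) => [n|w _].
  apply: measurable_funM => //; apply: measurable_indic.
  exact: measurable_regular_points.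
exact: cvg_regularization.
Qed.

Definition regular_version (u : R) : {RV P >-> R} :=
  HB.pack (regularization u)
    (@isMeasurableFun.Build _ _ _ _ (regularization u) (measurable_regularization u)).

(** The squared errors along dyadic approximations have summable expectations. *)
Lemma ae_cvg_dyadic u :
  {ae P, forall w, Z (dyadic_floor n u) w @[n --> \oo] --> Z u w}.
Proof.
have [K ZK] := @Z_moments 1 isT.
have K0 : 0 <= K.
  have : (0 <= (K * `|(0 : R) - 1| ^+ 1)%:E)%E; last first.
    by rewrite lee_fin sub0r normrN normr1 mulr1.
  apply: le_trans (ZK 0 1).
  by apply: integral_ge0 => w _; rewrite lee_fin exprn_even_ge0.
have H : {ae P, forall w,
    (\sum_(n <oo) ((Z (dyadic_floor n u) w - Z u w) ^+ 1.*2)%:E < +oo)%E}.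
  apply: (@ae_summable _ _ _ _ (fun n w => (Z (dyadic_floor n u) w - Z u w) ^+ 1.*2) K).
  - by move=> n; exact: measurable_sub_power.
  - by move=> n w; exact: exprn_even_ge0.
  move=> n; apply: le_trans (ZK _ _) _; rewrite lee_fin expr1 ler_wpM2l//.
  have /andP[h1 h2] := dyadic_floor_itv n u.
  rewrite ler_norml; apply/andP; split; lra.
apply: filterS H => w /(summable_cvg0 (fun m => exprn_even_ge0 _ _)) h.
have {}h : Num.sqrt ((Z (dyadic_floor n u) w - Z u w) ^+ 1.*2) @[n --> \oo] --> (0 : R).
  rewrite -[X in _ --> X]sqrtr0; apply: cvg_comp h _; exact: sqrt_continuous.
apply/cvgrPdist_lt => e e0.
move/cvgrPdist_lt: h => /(_ e e0); apply: filterS => n /=.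
by rewrite sub0r normrN sqrtr_sqr normr_id distrC.
Qed.

(** Kolmogorov's continuity criterion, with moments of all even orders: the version
    is the limit along dyadic floors of the argument, which is Hoelder wherever the
    dyadic increments are controlled and almost surely equals Z. *)
Theorem kolmogorov_continuity : exists Z' : R -> {RV P >-> R}, version_of Z Z' /\
  forall (w : T) (alpha : R), 0 < alpha < 1 / 2 ->
    hoelder_continuous alpha (fun u => Z' u w).
Proof.
exists regular_version; split=> [u|w alpha a012 a b].
  apply: filterS2 ae_regular_points (ae_cvg_dyadic u) => w rw cw.
  have := @cvg_regularization u w; rewrite indicE mem_set//.
  under eq_fun do rewrite mul1r.
  by move=> h; exact: (cvg_unique _ h cw).
have [rw|rw] := pselect (regular_points w); last first.
  exists 0 => s t _ _.
  have R0 v : regular_version v w = 0.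
    rewrite /= /regularization (_ : (fun n => _) = cst 0) ?lim_cst//.
    by apply/funext => n; rewrite indicE memNset// mul0r.
  by rewrite !R0 subrr normr0 mul0r.
pose N := (Num.truncn (Num.max `|a| `|b|)).+1.
have abN : Num.max `|a| `|b| < N%:R by exact: truncnS_gt.
have a0 : 0 < alpha < 2^-1 by move: a012; rewrite div1r.
have [C C0 hC] := regular_increment_bound N rw a0.
have a1 : 0 < alpha <= 1 by case/andP: a0 => ? ?; apply/andP; split; lra.
have [C' hC'] := @dyadic_hoelder R (fun v => Z v w) N C alpha C0 a1 hC.
exists C' => s t; rewrite !in_itv/= => /andP[as_ sb] /andP[at_ tb].
have RE v : regular_version v w = limn (fun m => Z (dyadic_floor m v) w).
  rewrite /= /regularization; congr (lim (_ @ \oo)); apply/funext => n.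
  by rewrite indicE mem_set// mul1r.
move: abN; rewrite gt_max !ltr_norml => /andP[/andP[h1 h2] /andP[h3 h4]].
have := RE s; have := RE t; rewrite /= => -> ->; apply: hC'; apply/andP; split; lra.
Qed.

End kolmogorov_continuity.

(** * The process driven by white noise *)

Section Zprocess.
Context d (T : measurableType d) (R : realType) (P : probability T R).
Variable W : (measurableTypeR R * measurableTypeR R -> R) -> {RV P >-> R}.
Hypothesis hW : white_noise (strip_measure R) W.

Local Notation Z := (Zprocess W).

Definition Zcov (u v : R) : R := ln (1 + expR (- `|u - v|)) / ln 2.

Let c : R := (Num.sqrt (ln 2))^-1.

Let ln2_gt0 : 0 < ln 2 :> R. Proof. by rewrite ln_gt0// ltr1n. Qed.

Lemma ZprocessE u w : Z u w = W (Zkernel u) w * c. Proof. by []. Qed.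

Lemma Lfun2_W u : (W (Zkernel u) : T -> R) \in Lfun P 2%:E.
Proof.
apply: sqr_integrable_Lfun2; first exact: measurable_funPT.
have := wn_covariance hW (Lfun2_Zkernel u) (Lfun2_Zkernel u).
rewrite integral_ZkernelM unlock => h.
have -> : (\int[P]_w (W (Zkernel u) w ^+ 2)%:E = (ln (1 + expR (- `|u - u|)))%:E)%E.
  by rewrite -h; apply: eq_integral => w _; rewrite expr2.
exact: ltry.
Qed.

Lemma Lfun2_Z u : (Z u : T -> R) \in Lfun P 2%:E.
Proof. by apply: (@Lfun_scale _ _ _ P) (Lfun2_W u); rewrite ler1n. Qed.

Lemma integral_ZM u v : (\int[P]_w (Z u w * Z v w)%:E = (Zcov u v)%:E)%E.
Proof.
have := wn_covariance hW (Lfun2_Zkernel u) (Lfun2_Zkernel v).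
rewrite integral_ZkernelM unlock => h.
have c2 : c * c = (ln 2)^-1 by rewrite -expr2 /c exprVn sqr_sqrtr// ltW.
under eq_integral => w _.
  by rewrite !ZprocessE mulrACA c2 EFinM; over.
rewrite integralZr//; first by rewrite h -EFinM.
by apply/Lfun1_integrable; exact: Lfun2_mul_Lfun1 (Lfun2_W u) (Lfun2_W v).
Qed.

Lemma centered_Z : centered Z.
Proof.
move=> u; rewrite (_ : (Z u : T -> R) = c \o* W (Zkernel u))//.
rewrite expectationZl; first by rewrite (wn_centered hW) ?mule0// Lfun2_Zkernel.
by apply: Lfun_subset12 (Lfun2_W u); rewrite fin_num_measure.
Qed.

Lemma gaussian_Z : gaussian_process Z.
Proof.
move=> n u a _; have := wn_gaussian hW.
move=> /(_ n (fun k => Zkernel (u k)) (fun k => a k * c))[k|m [s h]].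
  exact: Lfun2_Zkernel.
exists m, s => B mB; rewrite -h//; congr (pushforward P _ B).
by apply/funext => w; apply: eq_bigr => k _; rewrite ZprocessE mulrAC mulrA.
Qed.

Lemma Zcov_shift u v h : Zcov (u + h) (v + h) = Zcov u v.
Proof. by rewrite /Zcov (_ : u + h - (v + h) = u - v)//; ring. Qed.

(** Concretely ln 2 - ln (1 + exp(-h)) <= h, since 2 <= exp h + 1. *)
Lemma Zcov_increment u v :
  Zcov u u - Zcov u v - Zcov v u + Zcov v v <= 2 / ln 2 * `|u - v|.
Proof.
rewrite /Zcov (distrC v u) !subrr normr0 oppr0 expR0 (_ : 1 + 1 = 2)//.
have hle : ln 2 - ln (1 + expR (- `|u - v|)) <= `|u - v|.
  rewrite lerBlDr -{1}(expRK `|u - v|) -lnM ?posrE ?expR_gt0 ?addr_gt0 ?expR_gt0//.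
  rewrite ler_ln ?posrE ?mulr_gt0 ?addr_gt0 ?expR_gt0//.
  rewrite mulrDr mulr1 -expRD subrr expR0.
  have : 1 <= expR `|u - v| by rewrite -expR0 ler_expR.
  by move=> ?; lra.
have /(ler_wpM2l (x := 2 / ln 2)) : 0 <= 2 / ln 2 :> R by rewrite divr_ge0// ltW.
move=> /(_ _ _ hle); apply: le_trans; rewrite le_eqVlt; apply/orP; left; apply/eqP.
by ring.
Qed.

End Zprocess.

Theorem theorem1p5 (R : realType) (d : measure_display) (T : measurableType d)
    (P : probability T R)
    (W : (measurableTypeR R * measurableTypeR R -> R) -> {RV P >-> R})
    (hW : white_noise (strip_measure R) W) :
  let Z := Zprocess W in
  [/\ stationary Z, centered Z, gaussian_process Z,
      forall u v : R, covariance P (Z u) (Z v) =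
        (ln (1 + expR (- `|u - v|)) / ln 2)%:E
    & exists Z' : R -> {RV P >-> R}, version_of Z Z' /\
        forall (w : T) (alpha : R), 0 < alpha < 1 / 2 ->
          hoelder_continuous alpha (fun u => Z' u w)].
Proof.
have gZ := gaussian_Z hW; have cZ := centered_Z hW; have Z2 := Lfun2_Z hW.
have covZ := integral_ZM hW.
split.
- exact: (shift_invariant_stationary gZ cZ Z2 covZ (@Zcov_shift R)).
- exact: cZ.
- exact: gZ.
- exact: (centered_covariance cZ Z2 covZ).
- exact: kolmogorov_continuity (increment_moments gZ cZ Z2 covZ (@Zcov_increment R)).
Qed.
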